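(* For each of the three processes $\mathrm{SIP}(2k)$, $\mathrm{SEP}(2j)$, $\mathrm{IRW}$, the (single-site) self-duality functions $$D(x,n)=\langle D^{\rm cl}_{-q}(x,\cdot),D^{\rm cl}_{-q}(n,\cdot)\rangle_q\qquad\text{and}\qquad \widetilde D(x,n)=\langle D^{\rm cl}_{-p}(\cdot,x),D^{\rm cl}_{-p}(\cdot,n)\rangle_q$$ are biorthogonal with respect to the stationary measure of the associated process. In detail: 1. For $\mathrm{SIP}(2k)$, $$D(x,n)={}_2F_1\Big(-x,-n;2k;\tfrac1q\Big),\qquad \widetilde D(x,n)=\Big(-\frac{q}{p(1-q)}\Big)^{n+x}(1-q)^{-2k}\,{}_2F_1\Big(-x,-n;2k;\tfrac1q\Big),$$ and they are biorthogonal with respect to the measure $w_{p,k}$. In particular, for the choice $\frac1q=1-\frac1p$ one has $D(x,n)=M(x,n;p)$ and $\widetilde D(x,n)=(1-p)^{2k}D(x,n)$, so that the biorthogonality relation recovers the orthogonality relation of the Meixner polynomials. 2. For $\mathrm{SEP}(2j)$, $$D(x,n)={}_2F_1\Big(-x,-n;-2j;\tfrac{q-1}q\Big),\qquad \widetilde D(x,n)=\Big(\frac{q(p-1)}{p}\Big)^{n+x}(1-q)^{-2j}\,{}_2F_1\Big(-x,-n;-2j;\tfrac{q-1}q\Big),$$ and they are biorthogonal with respect to the measure $w_{p,j}$. In particular, for the choice $\frac1q=1-\frac1p$ one has $D(x,n)=K(x,n;p)$ and $\widetilde D(x,n)=(1-p)^{2j}D(x,n)$, so that the biorthogonality relation recovers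 the orthogonality relation of the Krawtchouk polynomials. 3. For $\mathrm{IRW}$, $$D(x,n)={}_2F_0\Big(-x,-n;-;\tfrac1q\Big),\qquad \widetilde D(x,n)=\Big(-\frac qp\Big)^{x+n}e^{q}\,{}_2F_0\Big(-x,-n;-;\tfrac1q\Big),$$ and they are biorthogonal with respect to the measure $w_p$. In particular, for the choice $q=-p$ one has $D(x,n)=C(x,n;p)$ and $\widetilde D(x,n)=e^{-p}D(x,n)$, so that the biorthogonality relation recovers the orthogonality relation of the Charlier polynomials.
   Context: $\mathbb N=\{0,1,2,\dots\}$; $x,n\in\mathbb N$ for SIP and IRW, $x,n\in\{0,\dots,2j\}$ for SEP. Here $k>0$, $2j$ is a positive integer, $0<p<1$ for SIP and SEP, $p>0$ for IRW, and $q$ is a real parameter. **Processes.** On a graph with vertex set $V$ and edge set $E$, $\mathbf x^{i,l}$ is the configuration obtained from $\mathbf x=(x_i)_{i\in V}$ by moving one particle from $i$ to $l$. The generators are $L=\sum_{\{i,l\}\in E}L_{i,l}$ with $L_{i,l}f(\mathbf x)=c(x_i,x_l)[f(\mathbf x^{i,l})-f(\mathbf x)]+c(x_l,x_i)[f(\mathbf x^{l,i})-f(\mathbf x)]$, where $c(u,v)=u(2k+v)$ for $\mathrm{SIP}(2k)$ (state space $\mathbb N^V$), $c(u,v)=u(2j-v)$ for $\mathrm{SEP}(2j)$ (state space $\{0,\dots,2j\}^V$), $c(u,v)=u$ for $\mathrm{IRW}$ (state space $\mathbb N^V$). A function $d(x,y)$ of two occupation numbers is a single-site self-duality function if $\mathcal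 D(\mathbf x,\mathbf y)=\prod_i d(x_i,y_i)$ satisfies $[L\mathcal D(\cdot,\mathbf y)](\mathbf x)=[L\mathcal D(\mathbf x,\cdot)](\mathbf y)$ for all $\mathbf x,\mathbf y$. **Measures.** Non-normalized single-site reversible measures: $\mu_q(z)=\frac{\Gamma(2k+z)}{\Gamma(2k)\,z!}q^z$ (SIP), $\mu_q(z)=\binom{2j}{z}\big(\frac q{1-q}\big)^z$ (SEP), $\mu_q(z)=\frac{q^z}{z!}$ (IRW); $\langle f,g\rangle_q=\sum_z f(z)g(z)\mu_q(z)$. Normalized: $w_{p,k}(x)=\mu_p(x)(1-p)^{2k}$, $w_{p,j}(x)=\mu_p(x)(1-p)^{2j}$, $w_p(x)=\mu_p(x)e^{-p}$ respectively. **Classical self-duality functions.** - SIP: $D^{\rm cl}_{-r}(x,y)=\frac{x!}{(x-y)!}\frac{\Gamma(2k)}{\Gamma(2k+y)}\big(-\frac1r\big)^y\mathbf 1_{\{y\le x\}}$; - SEP: $D^{\rm cl}_{-r}(x,y)=\frac{x!}{(x-y)!}\frac{(2j-y)!}{(2j)!}\big(-\frac{1-r}r\big)^y\mathbf 1_{\{y\le x\}}$; - IRW: $D^{\rm cl}_{-r}(x,y)=\frac{x!}{(x-y)!}\big(-\frac1r\big)^y\mathbf 1_{\{y\le x\}}$. **Biorthogonality.** The biorthogonality relation is $\langle D(\cdot,m),\widetilde D(\cdot,n)\rangle_p=\frac{\delta_{m,n}}{\mu_p(m)}$; the normalized stationary measure ($w_{p,k}$, $w_{p,j}$ or $w_p$)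 differs from $\mu_p$ only by a constant factor. **Polynomials.** $M(x,n;p)={}_2F_1(-x,-n;2k;1-\frac1p)$, $K(x,n;p)={}_2F_1(-x,-n;-2j;\frac1p)$, $C(x,n;p)={}_2F_0(-x,-n;-;-\frac1p)$.
   Formalization: q ≠ 0 (and q ≠ 1 for SEP) is assumed; for SIP, D̃ as a pairing needs |q|<1 and biorthogonality needs q<1/2, since the series diverge otherwise; for q ≤ −1 (so p ≥ 1/2 in the Meixner case) D̃ is taken to be its closed form. *)

(* Defs.v *)
From HB Require Import structures.
From mathcomp Require Import all_boot all_order all_algebra.
From mathcomp Require Import all_classical all_reals all_analysis.

Set Implicit Arguments.
Unset Strict Implicit.
Unset Printing Implicit Defensive.

Import Order.TTheory GRing.Theory Num.Theory.
Import numFieldNormedType.Exports.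

Local Open Scope classical_set_scope.
Local Open Scope ring_scope.

(** Euler's integral; used only for [0 < s]. *)
Definition Gamma (R : realType) (s : R) : R :=
  \int[lebesgue_measure]_(t in `]0, +oo[) (t `^ (s - 1) * expR (- t)).

(** Rising factorial [(a)_n = a (a + 1) ... (a + n - 1)]. *)
Definition poch (R : realType) (a : R) (n : nat) : R :=
  \prod_(i < n) (a + i%:R).

(** Generalized hypergeometric series [pFq (a_1, ..; b_1, ..; z)].  When some
    upper parameter is [- x] with [x] a natural number, all terms of index
    greater than [x] vanish; this includes the terms whose denominator
    [(- N)_m], [m > N], is zero when [x <= N], since [0 / 0 = 0]. *)
Definition hypergeom (R : realType) (a b : seq R) (z : R) : R :=
  limn (series (fun m : nat =>
    (\prod_(c <- a) poch c m) / (\prod_(c <- b) poch c m) * z ^+ m / m`!%:R)).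

Definition F21 (R : realType) (a b c z : R) : R := hypergeom [:: a; b] [:: c] z.
Definition F20 (R : realType) (a b z : R) : R := hypergeom [:: a; b] [::] z.

Section Duality.
Context {R : realType} {V : finType}.
Implicit Types (c : nat -> nat -> R) (x y : {ffun V -> nat})
  (f : {ffun V -> nat} -> R).

(** The truncated predecessor is harmless: every rate [c u v] below vanishes
    for [u = 0].  For the exclusion process [c u v] also vanishes when [v] is
    the maximal occupation, so that the dynamics stays in the state space. *)
Definition move x (i l : V) : {ffun V -> nat} :=
  [ffun v => if v == i then (x v).-1 else if v == l then (x v).+1 else x v].

Definition bond_generator c (i l : V) f x : R :=
  c (x i) (x l) * (f (move x i l) - f x) +
  c (x l) (x i) * (f (move x l i) - f x).

(** Sum over unordered edges: [bond_generator] is symmetric in [i] and [l], and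
    the condition on [enum_rank] picks one orientation of each edge. *)
Definition generator c (e : rel V) f x : R :=
  \sum_(i : V) \sum_(l : V | e i l && (enum_rank i < enum_rank l)%N)
    bond_generator c i l f x.

Definition prod_duality (d : nat -> nat -> R) x y : R :=
  \prod_(i : V) d (x i) (y i).

End Duality.

(** [d] is a single-site self-duality function of the process with rates [c]
    and single-site state space [S], on every finite simple graph. *)
Definition self_duality (R : realType) (S : pred nat)
    (c : nat -> nat -> R) (d : nat -> nat -> R) : Prop :=
  forall (V : finType) (e : rel V), symmetric e -> irreflexive e ->
  forall x y : {ffun V -> nat}, (forall i, S (x i)) -> (forall i, S (y i)) ->
    generator c e (fun x' => prod_duality d x' y) x =
    generator c e (fun y' => prod_duality d x y') y.

Definition rate_SIP (R : realType) (k : R) (u v : nat) : R :=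
  u%:R * (2 * k + v%:R).
Definition rate_SEP (R : realType) (N : nat) (u v : nat) : R :=
  u%:R * (N%:R - v%:R).
Definition rate_IRW (R : realType) (u v : nat) : R := u%:R.

Section Pairings.
Context {R : realType}.
Implicit Types (mu h f g : nat -> R) (D E : nat -> nat -> R).

Definition inner_nat mu f g : R :=
  limn (series (fun z : nat => f z * g z * mu z)).

(** Absolute convergence of the series defining [inner_nat]. *)
Definition inner_nat_cvg mu f g : Prop :=
  cvgn [normed series (fun z : nat => f z * g z * mu z)].

Definition inner_le (N : nat) mu f g : R :=
  \sum_(z < N.+1) f z * g z * mu z.

Definition biorthogonal_nat mu h D E : Prop :=
  forall m n : nat,
    inner_nat_cvg mu (D ^~ m) (E ^~ n) /\
    inner_nat mu (D ^~ m) (E ^~ n) = (m == n)%:R * h m.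

Definition biorthogonal_le (N : nat) mu h D E : Prop :=
  forall m n : nat, (m <= N)%N -> (n <= N)%N ->
    inner_le N mu (D ^~ m) (E ^~ n) = (m == n)%:R * h m.

End Pairings.

(** For all three processes [Dcl_ r] is the classical duality function with
    subscript [- r], and [Dt_] is the function written D with a tilde. *)

Section SIP.
Context {R : realType}.
Implicit Types (k p q r : R).

Definition mu_SIP k q (z : nat) : R :=
  Gamma (2 * k + z%:R) / (Gamma (2 * k) * z`!%:R) * q ^+ z.

Definition w_SIP k p (x : nat) : R := mu_SIP k p x * (1 - p) `^ (2 * k).

Definition Dcl_SIP k r (x y : nat) : R :=
  if (y <= x)%N then
    x`!%:R / (x - y)`!%:R * (Gamma (2 * k) / Gamma (2 * k + y%:R)) *
    (- r^-1) ^+ y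
  else 0.

Definition D_SIP k q (x n : nat) : R :=
  inner_nat (mu_SIP k q) (Dcl_SIP k q x) (Dcl_SIP k q n).

Definition Dt_SIP k p q (x n : nat) : R :=
  inner_nat (mu_SIP k q) (Dcl_SIP k p ^~ x) (Dcl_SIP k p ^~ n).

(** Closed form of [Dt_SIP], which makes sense for all [q < 1], [q != 0],
    whereas the series defining [Dt_SIP] requires [`|q| < 1]. *)
Definition Dt_SIP_closed k p q (x n : nat) : R :=
  (- (q / (p * (1 - q)))) ^+ (n + x) * (1 - q) `^ (- (2 * k)) *
  F21 (- x%:R) (- n%:R) (2 * k) q^-1.

Definition meixner k p (x n : nat) : R :=
  F21 (- x%:R) (- n%:R) (2 * k) (1 - p^-1).

End SIP.

(** [N] stands for [2j]. *)

Section SEP.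
Context {R : realType}.
Implicit Types (N : nat) (p q r : R).

Definition mu_SEP N q (z : nat) : R := 'C(N, z)%:R * (q / (1 - q)) ^+ z.

Definition w_SEP N p (x : nat) : R := mu_SEP N p x * (1 - p) ^+ N.

Definition Dcl_SEP N r (x y : nat) : R :=
  if (y <= x)%N then
    x`!%:R / (x - y)`!%:R * ((N - y)`!%:R / N`!%:R) * (- ((1 - r) / r)) ^+ y
  else 0.

Definition D_SEP N q (x n : nat) : R :=
  inner_le N (mu_SEP N q) (Dcl_SEP N q x) (Dcl_SEP N q n).

Definition Dt_SEP N p q (x n : nat) : R :=
  inner_le N (mu_SEP N q) (Dcl_SEP N p ^~ x) (Dcl_SEP N p ^~ n).

Definition krawtchouk N p (x n : nat) : R :=
  F21 (- x%:R) (- n%:R) (- N%:R) p^-1.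

End SEP.

Section IRW.
Context {R : realType}.
Implicit Types (p q r : R).

Definition mu_IRW q (z : nat) : R := q ^+ z / z`!%:R.

Definition w_IRW p (x : nat) : R := mu_IRW p x * expR (- p).

Definition Dcl_IRW r (x y : nat) : R :=
  if (y <= x)%N then x`!%:R / (x - y)`!%:R * (- r^-1) ^+ y else 0.

Definition D_IRW q (x n : nat) : R :=
  inner_nat (mu_IRW q) (Dcl_IRW q x) (Dcl_IRW q n).

Definition Dt_IRW p q (x n : nat) : R :=
  inner_nat (mu_IRW q) (Dcl_IRW p ^~ x) (Dcl_IRW p ^~ n).

Definition charlier p (x n : nat) : R := F20 (- x%:R) (- n%:R) (- p^-1).

End IRW.

(* Main.v *)
Require Import Defs.
From HB Require Import structures.
From mathcomp Require Import all_boot all_order all_algebra.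
From mathcomp Require Import ring lra.
From mathcomp Require Import all_classical all_reals all_analysis.
From mathcomp Require Import measurable_realfun.
Import Order.TTheory GRing.Theory Num.Theory.
Import numFieldNormedType.Exports.
Set Implicit Arguments.
Unset Strict Implicit.
Unset Printing Implicit Defensive.
Local Open Scope classical_set_scope.
Local Open Scope ring_scope.

(** The three processes have rates [u (alpha + sigma v)] with [(alpha, sigma)]
    equal to [(2k, 1)], [(N, -1)] and [(1, 0)], and reversible weights
    [w_s(x) = phi_x s^x / x!], [phi_x] the product of [alpha + sigma i] over
    [i < x].  In all cases [D] is the kernel
    [d_t(x, y) = \sum_z t^z x^_z y^_z / (phi_z z!)], with falling factorials.
    A three-term recurrence for [d_t], together with the symmetry of
    [x (d_t(x, y) - d_t(x - 1, y))] in [x] and [y], turns self-duality on one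
    bond into a polynomial identity.  Adjointness of [f |-> x f(x - 1)] and
    [f |-> s (alpha + sigma x) f(x + 1)] for [w_s] gives a recurrence for the
    moments of [x^_m x^_n] solved by
    [Z phi_m phi_n v^(m + n) d_(1/s)(m, n)], [v = s / (1 - sigma s)]: this is
    the closed form of [D] tilde.  For [t = sigma - 1/s = - 1/v], pairing
    [x^_m] with [d_t(., n)] then yields alternating binomial sums, so that the
    [d_t(., n)] are orthogonal for [w_s].  As [D] tilde is
    [C b^(x + n) d_t(x, n)], absorbing [b^x] into the weight turns
    biorthogonality with respect to [w_p] into this orthogonality at
    [s = b p]. *)

(** * The duality kernel *)

Section Kernel.
Context {R : realFieldType} (alpha sigma : R).
Implicit Types (t s : R) (m n x y z : nat).

Definition phi n : R := \prod_(i < n) (alpha + sigma * i%:R).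

Lemma phi0 : phi 0 = 1.
Proof. by rewrite /phi big_ord0. Qed.

Lemma phiS n : phi n.+1 = phi n * (alpha + sigma * n%:R).
Proof. by rewrite /phi big_ord_recr. Qed.

(** The condition [phi n != 0] encodes the state space: it reads [n <= N] for exclusion and always
    holds for the other two processes. As [phi] is a product over initial segments, it passes to
    smaller arguments. *)
Lemma phi_neq0_le m n : (m <= n)%N -> phi n != 0 -> phi m != 0.
Proof.
elim: n => [|n IH]; first by rewrite leqn0 => /eqP->.
rewrite leq_eqVlt => /predU1P[->//|/IH h].
by rewrite phiS mulf_eq0 negb_or => /andP[/h].
Qed.

(* In the exclusion case [phi z = 0] for [z > N], and these coefficients are
   then [0] by the convention [x / 0 = 0]. *)
Definition dual_coef t z : R := t ^+ z / (phi z * z`!%:R).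

Definition dual t x y : R :=
  \sum_(z < (x + y).+1) dual_coef t z * (x ^_ z)%:R * (y ^_ z)%:R.

Lemma fact_neq0 n : n`!%:R != 0 :> R.
Proof. by rewrite pnatr_eq0 -lt0n fact_gt0. Qed.

Lemma big_ord_ffact_trim (F : nat -> R) n B :
  (n < B)%N ->
  \sum_(z < B) F z * (n ^_ z)%:R = \sum_(z < n.+1) F z * (n ^_ z)%:R.
Proof.
move=> nB; rewrite [RHS](big_ord_widen B (fun z => F z * (n ^_ z)%:R)) //.
rewrite [RHS]big_mkcond /=; apply: eq_bigr => z _.
by case: ltnP => // nz; rewrite ffact_small // mulr0.
Qed.

(** Every index beyond the smaller argument kills a falling factorial, so kernels at neighbouring
    arguments can be written over one common range. *)
Lemma dualE t x y B : (minn x y < B)%N ->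
  dual t x y = \sum_(z < B) dual_coef t z * (x ^_ z)%:R * (y ^_ z)%:R.
Proof.
have trimx C : (x < C)%N ->
    \sum_(z < C) dual_coef t z * (x ^_ z)%:R * (y ^_ z)%:R =
    \sum_(z < x.+1) dual_coef t z * (x ^_ z)%:R * (y ^_ z)%:R.
  move=> xC; under eq_bigr do rewrite mulrAC.
  under [RHS]eq_bigr do rewrite mulrAC.
  exact: (@big_ord_ffact_trim (fun z => dual_coef t z * (y ^_ z)%:R)).
have trimy C : (y < C)%N ->
    \sum_(z < C) dual_coef t z * (x ^_ z)%:R * (y ^_ z)%:R =
    \sum_(z < y.+1) dual_coef t z * (x ^_ z)%:R * (y ^_ z)%:R.
  exact: (@big_ord_ffact_trim (fun z => dual_coef t z * (x ^_ z)%:R)).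
rewrite /dual gtn_min => /orP[xB|yB].
  by rewrite [LHS]trimx ?ltnS ?leq_addr// [RHS]trimx.
by rewrite [LHS]trimy ?ltnS ?leq_addl// [RHS]trimy.
Qed.

Lemma dualC t x y : dual t x y = dual t y x.
Proof. by rewrite /dual addnC; apply: eq_bigr => z _; rewrite mulrAC. Qed.

Lemma dual0 t x : dual t x 0 = 1.
Proof.
rewrite (@dualE _ _ _ 1) ?minn0// big_ord1 /dual_coef phi0 !ffactn0 expr0.
by rewrite fact0 !mulr1 divr1.
Qed.

Lemma ffactSr_natr x z : (x ^_ z.+1)%:R = (x%:R - z%:R) * (x ^_ z)%:R :> R.
Proof.
rewrite ffactnSr natrM; case: (leqP z x) => zx; first by rewrite natrB// mulrC.
by rewrite ffact_small// mul0r mulr0.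
Qed.

Lemma ffactS_natr x z : (x ^_ z.+1)%:R = x%:R * (x.-1 ^_ z)%:R :> R.
Proof. by rewrite ffactnS natrM. Qed.

Lemma ffact_succ_natr x z :
  (x.+1 ^_ z)%:R = (x ^_ z)%:R + z%:R * (x ^_ z.-1)%:R :> R.
Proof.
case: z => [|z]; first by rewrite !ffactn0 mul0r addr0.
by rewrite ffactS_natr ffactSr_natr /= -[x.+1%:R]natr1 -[z.+1%:R]natr1; ring.
Qed.

(** Termwise [x (x^_z - x.-1^_z) = z x^_z], so both sides are the kernel sum with an extra factor
    [z]. *)
Lemma dual_number_diff t x y :
  x%:R * (dual t x y - dual t x.-1 y) = y%:R * (dual t x y - dual t x y.-1).
Proof.
pose B := (x + y).+1.
have xB : (x < B)%N by rewrite ltnS leq_addr.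
have yB : (y < B)%N by rewrite ltnS leq_addl.
rewrite !(@dualE _ _ _ B) ?gtn_min ?xB ?yB ?(leq_ltn_trans (leq_pred _) xB)
  ?orbT//.
rewrite !mulrBr !mulr_sumr -!sumrB; apply: eq_bigr => z _.
have e w : w%:R * (w.-1 ^_ z)%:R = (w%:R - z%:R) * (w ^_ z)%:R :> R.
  by rewrite -ffactS_natr ffactSr_natr.
have ex := e x; have ey := e y.
transitivity (dual_coef t z * (x%:R * (x ^_ z)%:R - x%:R * (x.-1 ^_ z)%:R) *
  (y ^_ z)%:R).
  by ring.
rewrite ex; transitivity
  (dual_coef t z * (x ^_ z)%:R * (y%:R * (y ^_ z)%:R - y%:R * (y.-1 ^_ z)%:R)).
  by rewrite ey; ring.
by ring.
Qed.

Lemma dual_coefS t z : phi z.+1 != 0 ->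
  dual_coef t z.+1 * z.+1%:R * (alpha + sigma * z%:R) = t * dual_coef t z.
Proof.
rewrite phiS mulf_eq0 negb_or => /andP[phi_n0 az].
rewrite /dual_coef phiS exprS factS natrM.
have := fact_neq0 z; have : z.+1%:R != 0 :> R by rewrite pnatr_eq0.
by move: z.+1%:R => z1 zn fn; field; rewrite az zn fn phi_n0.
Qed.

Lemma dual_rec t x y : phi y != 0 ->
  (alpha + sigma * x%:R) * dual t x.+1 y =
  (alpha + sigma * (x%:R + y%:R)) * dual t x y +
    (t - sigma) * y%:R * dual t x y.-1.
Proof.
move=> py; pose B := (x + y).+1.
have yB : (y < B.+1)%N by rewrite ltnS /B leqW// leq_addl.
have yB' : (y.-1 < B.+1)%N by rewrite (leq_ltn_trans (leq_pred _)).
rewrite !(@dualE _ _ _ B.+1) ?gtn_min ?yB ?yB' ?orbT//.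
(* For [z > 0] the bracket equals [(alpha + sigma (z - 1)) x^_(z - 1)], so the ratio of consecutive
   coefficients gives [c z.+1 = c' z], while [c 0 = 0]: the two sums agree after a shift of
   index. *)
pose c z := dual_coef t z * (y ^_ z)%:R * z%:R *
  ((alpha + sigma * x%:R) * (x ^_ z.-1)%:R - sigma * (x ^_ z)%:R).
pose c' z := t * dual_coef t z * (x ^_ z)%:R * (y ^_ z.+1)%:R.
have ccE : \sum_(z < B.+1) c z = \sum_(z < B.+1) c' z.
  rewrite big_ord_recl [RHS]big_ord_recr/= {1}/c {2}/c' mulr0 mul0r add0r.
  rewrite [in (y ^_ B.+1)]ffact_small// mulr0 addr0; apply: eq_bigr => z _.
  rewrite /c /c' /bump /= add1n.
  (* For [z < y] the hypothesis on [phi y] gives [phi z.+1 != 0]; for [z >= y] both terms contain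
     [y^_z.+1 = 0]. *)
  case: (ltnP z y) => zy; last by rewrite ffact_small// !(mulr0, mul0r).
  rewrite -dual_coefS; last exact: phi_neq0_le py.
  by rewrite (ffactSr_natr x); ring.
rewrite -[X in _ * X +
  _]/(\sum_(z < B.+1) (fun z : nat => dual_coef t z * (x ^_ z)%:R * (y ^_ z)%:R)
  z).
have -> : (t - sigma) * y%:R * \sum_(z < B.+1) dual_coef t z * (x ^_ z)%:R *
  (y.-1 ^_ z)%:R =
   \sum_(z < B.+1) c z - \sum_(z < B.+1) sigma * dual_coef t z * (x ^_ z)%:R *
     (y ^_ z.+1)%:R.
  rewrite ccE -sumrB mulr_sumr; apply: eq_bigr => z _.
  by rewrite /c' ffactS_natr; ring.
rewrite -sumrB !mulr_sumr -big_split/=; apply: eq_bigr => z _.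
by rewrite /c ffact_succ_natr (ffactSr_natr y); ring.
Qed.

(* The bond generator is quadratic in the operators [f |-> x f(x - 1)] and
   [f |-> (alpha + sigma x) f(x + 1)], whose actions on [d] in either variable
   are given by [dual_number_diff] and [dual_rec]. *)
Lemma dual_bond t (c := fun u v : nat => u%:R * (alpha + sigma * v%:R)) x1 x2 y1
  y2 :
  phi x1 != 0 -> phi x2 != 0 -> phi y1 != 0 -> phi y2 != 0 ->
  c x1 x2 * (dual t x1.-1 y1 * dual t x2.+1 y2 - dual t x1 y1 * dual t x2 y2) +
  c x2 x1 * (dual t x1.+1 y1 * dual t x2.-1 y2 - dual t x1 y1 * dual t x2 y2) =
  c y1 y2 * (dual t x1 y1.-1 * dual t x2 y2.+1 - dual t x1 y1 * dual t x2 y2) +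
  c y2 y1 * (dual t x1 y1.+1 * dual t x2 y2.-1 - dual t x1 y1 * dual t x2 y2).
Proof.
move=> px1 px2 py1 py2.
have e1 := dual_number_diff t x1 y1; have e2 := dual_number_diff t x2 y2.
have r1 := dual_rec t x1 py1; have r2 := dual_rec t x2 py2.
have r1' := dual_rec t y1 px1; have r2' := dual_rec t y2 px2.
rewrite !(dualC _ y1.+1) !(dualC _ y2.+1) !(dualC t y1) !(dualC t y2) in r1'
  r2'.
rewrite /c.
transitivity (x1%:R * dual t x1.-1 y1 *
  ((alpha + sigma * x2%:R) * dual t x2.+1 y2) +
  x2%:R * dual t x2.-1 y2 * ((alpha + sigma * x1%:R) * dual t x1.+1 y1) -
  (x1%:R * (alpha + sigma * x2%:R) + x2%:R * (alpha + sigma * x1%:R)) *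
    (dual t x1 y1 * dual t x2 y2)).
  by ring.
transitivity (y1%:R * dual t x1 y1.-1 *
  ((alpha + sigma * y2%:R) * dual t x2 y2.+1) +
  y2%:R * dual t x2 y2.-1 * ((alpha + sigma * y1%:R) * dual t x1 y1.+1) -
  (y1%:R * (alpha + sigma * y2%:R) + y2%:R * (alpha + sigma * y1%:R)) *
    (dual t x1 y1 * dual t x2 y2)); last by ring.
rewrite r1 r2 r1' r2'.
(* The terms lowered in [x] are eliminated in favour of those lowered in [y]; what remains is a
   polynomial identity in the kernel values left. *)
have {}e1 : x1%:R * dual t x1.-1 y1 =
  x1%:R * dual t x1 y1 - y1%:R * dual t x1 y1 + y1%:R * dual t x1 y1.-1 by lra.
have {}e2 : x2%:R * dual t x2.-1 y2 =
  x2%:R * dual t x2 y2 - y2%:R * dual t x2 y2 + y2%:R * dual t x2 y2.-1 by lra.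
rewrite -[(t - sigma) * x1%:R * _]mulrA -[(t - sigma) * x2%:R * _]mulrA e1 e2.
by ring.
Qed.

(** Up to sign this is the [n]-th finite difference at [0] of the polynomial [z^_j]: zero for
    [j < n] by degree, and zero for [j > n] because all the values vanish. The induction absorbs one
    factor [z] into the binomial coefficient. *)
Lemma alternating_binomial_ffact n j :
  \sum_(z < n.+1) (-1) ^+ z * 'C(n, z)%:R * (z ^_ j)%:R =
  (j == n)%:R * ((-1) ^+ n * n`!%:R) :> R.
Proof.
elim: j n => [|j IH] [|n].
- by rewrite big_ord1 bin0 ffactn0 fact0 expr0 !mulr1.
- rewrite mul0r -[RHS](expr0n R n.+1) -[in RHS](subrr 1) exprBn.
  by apply: eq_bigr => z _; rewrite !expr1n ffactn0 !mulr1 mulr_natr.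
- by rewrite big_ord1 ffact0n !mulr0 mul0r.
- rewrite big_ord_recl ffact0n mulr0 add0r.
  rewrite (eq_bigr
    (fun z : 'I_n.+1 => - n.+1%:R * ((-1) ^+ z * 'C(n, z)%:R * (z ^_ j)%:R))).
    rewrite -mulr_sumr IH eqSS exprS factS natrM.
    by case: eqP => _; rewrite ?mul0r ?mulr0// !mul1r mulrACA mulN1r.
  move=> z _; rewrite lift0 ffactnS natrM /= exprS.
  have e : 'C(n.+1, z.+1)%:R * z.+1%:R = n.+1%:R * 'C(n, z)%:R :> R.
    by rewrite -!natrM mulnC -mul_bin_diag.
  transitivity (- (-1) ^+ z * ('C(n.+1, z.+1)%:R * z.+1%:R) * (z ^_ j)%:R :> R);
    first by ring.
  by rewrite e; ring.
Qed.

(** * Moments of falling factorials *)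

Section Moments.
(** [W m n] abstracts the sum of [x^_m x^_n] against the weight, which separates the algebra from
    convergence. [W_shift] reflects [(x - n) - (x - m) = m - n], and [W_adj] the adjointness
    relation. *)
Variables (s : R) (W : nat -> nat -> R).
Hypotheses (s0 : s != 0) (ss : 1 - sigma * s != 0).
Hypothesis WC : forall m n, W m n = W n m.
Hypothesis W_shift : forall m n, W m n.+1 - W m.+1 n = (m%:R - n%:R) * W m n.
Hypothesis W_adj : forall m n, W m n.+1 =
  s * (sigma * W m.+1 n + (alpha + 2 * sigma * m%:R) * W m n +
       m%:R * (alpha + sigma * (m%:R - 1)) * W m.-1 n).

Let v := s / (1 - sigma * s).

(** Eliminating [W m.+1 n] from [W_adj] by [W_shift] leaves [(1 - sigma s) W m n.+1] on the left,
    whence the factor [v]. *)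
Lemma moment_rec m n : W m n.+1 =
  v * ((alpha + sigma * (m%:R + n%:R)) * W m n +
       m%:R * (alpha + sigma * (m%:R - 1)) * W m.-1 n).
Proof.
have e1 : W m.+1 n = W m n.+1 - (m%:R - n%:R) * W m n by rewrite -W_shift; ring.
have e2 := W_adj m n; rewrite e1 in e2.
apply: (mulfI ss); rewrite /v mulrA [(_ - _) * (_ / _)]mulrC divfK//.
by rewrite mulrBl {1}e2; ring.
Qed.

Lemma moment_dual m n : phi m != 0 ->
  W m n = W 0 0 * phi m * phi n * v ^+ (m + n) * dual s^-1 m n.
Proof.
have W0 l : W 0 l = W 0 0 * phi l * v ^+ l.
  elim: l => [|l IH]; first by rewrite phi0 expr0 !mulr1.
  by rewrite moment_rec IH phiS exprS; ring.
elim: n m => [|n IH] m pm.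
  by rewrite WC W0 phi0 dual0 addn0; ring.
rewrite moment_rec IH// phiS addnS exprS.
(* This is the coefficient [t - sigma] of [dual_rec] at [t = s^-1]; the inverse matches the power of
   [v] by which [W m n] and [W m.-1 n] differ. *)
have vV : s^-1 - sigma = v^-1 by rewrite /v; field; rewrite s0 ss.
have := dual_rec s^-1 n pm; rewrite !(dualC _ n) (dualC _ n.+1) vV => e.
have v0 : v != 0 by rewrite /v mulf_neq0 ?invr_eq0.
have -> : W 0 0 * phi m * (phi n * (alpha + sigma * n%:R)) *
  (v * v ^+ (m + n)) * dual s^-1 m n.+1 =
  W 0 0 * phi m * phi n * (v * v ^+ (m + n)) *
    ((alpha + sigma * n%:R) * dual s^-1 m n.+1).
  by ring.
rewrite e; case: m pm {e} => [|m] pm; first by ring.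
rewrite IH; last exact: phi_neq0_le pm.
by rewrite /= addSn exprS phiS -natr1; field.
Qed.

Let t := sigma - s^-1.

(** Since [t v = -1], inserting [moment_dual] and exchanging the sums leaves one alternating
    binomial sum for each [j], and only [j = n] survives. *)
Lemma dual_moment_row i n : phi i != 0 -> phi n != 0 ->
  \sum_(z < n.+1) dual_coef t z * (n ^_ z)%:R * W i z =
  W 0 0 * phi i * v ^+ i * ((-1) ^+ n * s ^- n / phi n * (i ^_ n)%:R).
Proof.
move=> pi pn.
have tv : t * v = -1 by rewrite /t /v; field; rewrite s0 ss.
transitivity (\sum_(z < n.+1) \sum_(j < (i + n).+1)
   W 0 0 * phi i * v ^+ i * (dual_coef s^-1 j * (i ^_ j)%:R) *
     ((-1) ^+ z * 'C(n, z)%:R * (z ^_ j)%:R)).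
  apply: eq_bigr => z _.
  have zn : (z <= n)%N by rewrite -ltnS ltn_ord.
  have pz : phi z != 0 by exact: phi_neq0_le pn.
  rewrite moment_dual// (@dualE _ _ _ (i + n).+1); last first.
    by rewrite gtn_min ltnS leq_addr.
  rewrite !mulr_sumr; apply: eq_bigr => j _.
  have zE : (n ^_ z)%:R = 'C(n, z)%:R * z`!%:R :> R by rewrite -natrM bin_ffact.
  have gen (a b : R) : a * b = -1 -> a ^+ z * b ^+ (i + z) = b ^+ i * (-1) ^+ z.
    by move=> <-; rewrite exprD exprMn; ring.
  have z0 := fact_neq0 z.
  transitivity (W 0 0 * phi i * (dual_coef s^-1 j * (i ^_ j)%:R) * 'C(n, z)%:R *
    (z ^_ j)%:R *
    (t ^+ z * v ^+ (i + z))).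
    by rewrite zE {1}/dual_coef; field; rewrite z0 pz.
  by rewrite gen//; ring.
rewrite exchange_big/=.
under eq_bigr do rewrite -mulr_sumr alternating_binomial_ffact.
have nlt : (n < (i + n).+1)%N by rewrite ltnS leq_addl.
rewrite (bigD1 (Ordinal nlt))//= eqxx big1 ?addr0 => [|j]; last first.
  by rewrite -val_eqE/= => /negbTE->; rewrite mul0r mulr0.
rewrite mul1r /dual_coef exprVn; have n0 := fact_neq0 n.
have := expf_neq0 n s0; move: (s ^+ n) => sn sn0.
by field; rewrite n0 pn sn0.
Qed.

(** By symmetry take [m <= n]. The row sums carry the factor [i^_n], zero for [i < n], so among
    [i <= m] only [i = m = n] can contribute. *)
Lemma dual_orthogonal_moments m n : phi m != 0 -> phi n != 0 ->
  \sum_(i < m.+1) \sum_(z < n.+1) dual_coef t i * (m ^_ i)%:R *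
     (dual_coef t z * (n ^_ z)%:R * W i z) =
  (m == n)%:R * (W 0 0 * m`!%:R / (phi m * s ^+ m)).
Proof.
wlog mn : m n / (m <= n)%N => [hw pm pn|pm pn].
  case: (leqP m n) => [/hw|/ltnW nm]; first exact.
  rewrite exchange_big/=;
    transitivity (\sum_(i < n.+1) \sum_(z < m.+1) dual_coef t i * (n ^_ i)%:R *
     (dual_coef t z * (m ^_ z)%:R * W i z)).
    by apply: eq_bigr => i _; apply: eq_bigr => z _; rewrite WC; ring.
  by rewrite hw// eq_sym; case: eqP => [->//|_]; rewrite !mul0r.
have tv : t * v = -1 by rewrite /t /v; field; rewrite s0 ss.
under eq_bigr => i _.
  rewrite -mulr_sumr dual_moment_row//; last first.
    by apply: phi_neq0_le pm; rewrite -ltnS ltn_ord.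
  over.
have small (i : nat) : (i < n)%N -> (i ^_ n)%:R = 0 :> R by move/ffact_small->.
move: mn; rewrite leq_eqVlt => /predU1P[mn|mn].
  subst m; rewrite eqxx mul1r big_ord_recr/= big1 ?add0r => [|i _]; last first.
    by rewrite small// !mulr0.
  rewrite /dual_coef ffactnn.
  have -> : (-1) ^+ n = t ^+ n * v ^+ n by rewrite -exprMn tv.
  have n0 := fact_neq0 n; have sn := expf_neq0 n s0.
  (* The sign from the row sum, rewritten as [(t v)^n], joins the explicit powers of [t] and [v] in
     a square equal to [1]; the right-hand side is multiplied by the same square. *)
  have tvn : t ^+ n * v ^+ n * (t ^+ n * v ^+ n) = 1.
    by rewrite -exprMn tv -expr2 sqrr_sign.
  have tn0 : t ^+ n != 0 by apply: contra_eq_neq tvn => ->;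
    rewrite !mul0r eq_sym oner_eq0.
  have vn0 : v ^+ n != 0 by apply: contra_eq_neq tvn => ->;
    rewrite !mulr0 eq_sym oner_eq0.
  rewrite -[RHS]mulr1 -tvn; move: (s ^+ n) (t ^+ n) (v ^+ n) sn tn0 vn0 =>
    ? ? ? ? ? ?.
  by field; apply/and5P.
rewrite ltn_eqF// mul0r big1// => i _.
by rewrite small ?mulr0//; apply: leq_ltn_trans mn; rewrite -ltnS.
Qed.

End Moments.

End Kernel.

(** * Euler's Gamma function *)

Section GammaFunction.
Context {R : realType}.
Implicit Types (s t : R).
Notation mu := lebesgue_measure.

Let f s t : R := t `^ (s - 1) * expR (- t).

Let f_ge0 s t : 0 <= f s t.
Proof. by rewrite mulr_ge0 ?powR_ge0 ?expR_ge0. Qed.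

Let measurable_f s (D : set R) : measurable D ->
  measurable_fun D (fun t : R => (f s t)%:E).
Proof.
move=> mD; apply/measurable_EFinP; apply: measurable_funM.
  by apply: measurable_funTS; exact: measurable_powR.
apply: measurable_funTS; apply: measurableT_comp => //.
Qed.

(** Extended-real values make monotone convergence and the functional equation available before
    finiteness is known. *)
Definition eGamma s : \bar R := (\int[mu]_(t in `]0%R, +oo[) (f s t)%:E)%E.

(** Compact intervals exhausting the open half line, away from the possible singularity at [0], on
    which integration by parts applies. *)
Let J n : set R := `[n.+1%:R^-1, n.+1%:R]%classic.

Let nondecreasing_J : {homo J : n m / (n <= m)%N >-> (n <= m)%O}.
Proof.
move=> n m nm; apply/subsetPset => x; rewrite /J/= !in_itv/= => /andP[h1 h2].
apply/andP; split; last by rewrite (le_trans h2)// ler_nat.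
by apply: le_trans h1; rewrite lef_pV2 ?posrE// ler_nat.
Qed.

Let bigcup_J : \bigcup_n J n = `]0%R, +oo[%classic.
Proof.
apply/seteqP; split => x /=.
  by move=> [n _]; rewrite /J/= !in_itv/= => /andP[h _];
    rewrite andbT (lt_le_trans _ h).
rewrite in_itv/= andbT => x0.
have [n hn] : exists n : nat, x <= n.+1%:R /\ x^-1 <= n.+1%:R.
  exists (Num.truncn (x + x^-1)); split.
    by rewrite (le_trans _ (ltW (truncnS_gt _)))// lerDl invr_ge0 ltW.
  by rewrite (le_trans _ (ltW (truncnS_gt _)))// lerDr ltW.
exists n => //; rewrite /J/= in_itv/=; apply/andP; split; last by case: hn.
by rewrite -[x]invrK lef_pV2 ?posrE ?invr_gt0//; case: hn.
Qed.

Let cvg_eGamma s : (\int[mu]_(t in J n) (f s t)%:E)%E @[n --> \oo] --> eGamma s.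
Proof.
rewrite /eGamma -bigcup_J; apply: ge0_nondecreasing_set_cvg_integral => //.
- by move=> n; exact: measurable_itv.
- by move=> n; apply: measurable_f; exact: measurable_itv.
- by move=> n x _; rewrite lee_fin.
Qed.

Let cvg_at_infty s : 0 < s -> n.+1%:R `^ s * expR (- n.+1%:R) @[n --> \oo] -->
  (0 : R).
Proof.
(* As [M > s], the bound [expR x >= x^(M + 1) / (M + 1)!] leaves [(M + 1)! / x], which tends to
   [0]. *)
move=> s0; pose M := (Num.truncn s).+1.
apply: (@squeeze_cvgr _ _ _ _ (cst 0) (fun n => M.+1`!%:R * n.+1%:R^-1)).
- near=> n; apply/andP; split; first by rewrite mulr_ge0 ?powR_ge0 ?expR_ge0.
  have n0 : (0 : R) < n.+1%:R by [].
  apply: (@le_trans _ _ (n.+1%:R ^+ M * expR (- n.+1%:R))).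
    rewrite ler_wpM2r ?expR_ge0// -powR_mulrn ?ler0n// ler_powR ?ler1n//.
    by rewrite ltW// truncnS_gt.
  rewrite expRN ler_pdivrMr ?expR_gt0//.
  have := @expR_ge1Dxn R n.+1%:R M (ltW n0).
  move=> h; have {}h : n.+1%:R ^+ M.+1 / M.+1`!%:R <= expR n.+1%:R :> R.
    by apply: le_trans h; rewrite lerDr.
  have M0 : (0 : R) < M.+1`!%:R by rewrite ltr0n fact_gt0.
  move: h; rewrite ler_pdivrMr// => h.
  rewrite mulrAC ler_pdivlMr// -exprSr.
  by rewrite mulrC.
- exact: cvg_cst.
- rewrite -[X in _ --> X](mulr0 (M.+1`!%:R : R)).
  apply: cvgM; first exact: cvg_cst.
  exact: cvg_harmonic.
Unshelve. all: by end_near. Qed.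

Let cvg_at_zero s : 0 < s ->
  n.+1%:R^-1 `^ s * expR (- n.+1%:R^-1) @[n --> \oo] --> (0 : R).
Proof.
move=> s0.
have h : n.+1%:R^-1 `^ s @[n --> \oo] --> (0 : R).
  have /cvg_at_rightP := powR_cvg0 s0; apply; split => [n|];
    last exact: cvg_harmonic.
  by rewrite invr_gt0.
apply: (@squeeze_cvgr _ _ _ _ (cst 0) (fun n => n.+1%:R^-1 `^ s)) => //;
  last exact: cvg_cst.
near=> n; apply/andP; split; first by rewrite mulr_ge0 ?powR_ge0 ?expR_ge0.
by rewrite ler_piMr ?powR_ge0// -expR0 ler_expR oppr_le0 invr_ge0.
Unshelve. all: by end_near. Qed.

Let derive_NexpRN (x : R) :
  is_derive x 1 (fun t : R => - expR (- t)) (expR (- x)).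
Proof.
have -> : (fun t : R => - expR (- t)) = - (expR \o (-%R)) by apply/funext.
have d : is_derive x 1 (-%R : R -> R) (- 1) by exact: is_deriveN.
have := is_deriveN (is_derive1_comp (is_derive_expR (- x)) d).
by rewrite mulrN1 opprK.
Qed.

Let parts n s : (0 < n)%N -> 0 < s -> (\int[mu]_(t in J n) (f (s + 1) t)%:E =
    (n.+1%:R^-1 `^ s * expR (- n.+1%:R^-1) -
      n.+1%:R `^ s * expR (- n.+1%:R))%:E +
    s%:E * \int[mu]_(t in J n) (f s t)%:E)%E.
Proof.
move=> n0 s0.
have a0 : 0 < n.+1%:R^-1 :> R by [].
(* The assumption [0 < n] excludes the degenerate interval [J 0 = [1, 1]]; it holds eventually,
   which is enough for the limit. *)
have ab : n.+1%:R^-1 < n.+1%:R :> R.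
  by rewrite (@lt_trans _ _ 1)// ?invf_lt1 ?ltr1n// posrE.
have dpow (r x : R) : 0 < x -> derivable (@powR R ^~ r) x 1.
  by move=> x0; apply: derivable_powR; rewrite in_itv/= x0.
have pos (x : R) : x \in `[n.+1%:R^-1, n.+1%:R] -> 0 < x.
  by rewrite in_itv/= => /andP[h _]; apply: lt_le_trans h.
have poso (x : R) : x \in `]n.+1%:R^-1, n.+1%:R[ -> 0 < x.
  by rewrite in_itv/= => /andP[/ltW h _]; apply: lt_le_trans h.
have cpow (r x : R) : 0 < x -> {for x, continuous (@powR R ^~ r)}.
  by move=> x0; apply: differentiable_continuous; apply/derivable1_diffP;
    exact: dpow.
have := @integration_by_parts R (@powR R ^~ s) (fun x => - expR (- x))
  (fun x => s * x `^ (s - 1)) (fun x => expR (- x)) _ _ ab.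
under eq_integral do rewrite -[s in _ `^ s](addrK 1).
move=> -> //.
- rewrite (_ : (fun x : R => (s * x `^ (s - 1) * - expR (- x))%:E) =
    (fun x => - (s%:E * (f s x)%:E)%E)%E).
    rewrite integral_ge0N ?oppeK => [|x _];
      last by rewrite -EFinM lee_fin mulr_ge0 ?(ltW s0) ?f_ge0.
    have mJ : measurable (J n) by exact: measurable_itv.
    have -> : (\int[mu]_(t in J n) (s%:E * (f s t)%:E) =
      s%:E * \int[mu]_(t in J n) (f s t)%:E)%E.
      apply: ge0_integralZl => //; first exact: measurable_f.
        by move=> x _; rewrite lee_fin f_ge0.
      by rewrite lee_fin ltW.
    by congr (_%:E + _)%E; ring.
  by apply/funext => x; rewrite -EFinM -EFinN /f mulrN mulrA.
- apply: derivable_within_continuous => x /pos x0.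
  by apply: derivableM => //; exact: dpow.
- split => [x /poso x0||]; first exact: dpow.
  + by apply: cvg_at_right_filter; exact: cpow.
  + by apply: cvg_at_left_filter; apply: cpow; exact: lt_trans ab.
- by move=> x /poso x0; rewrite powR_derive1// in_itv/= x0.
- by apply: derivable_within_continuous => x _.
- have c (x : R) : {for x, continuous (fun t : R => - expR (- t))}.
    by apply: differentiable_continuous; apply/derivable1_diffP;
      exact: (@ex_derive _ _ _ _ _ _ _ (derive_NexpRN x)).
  split => [x _||]; first exact: (@ex_derive _ _ _ _ _ _ _ (derive_NexpRN x)).
  + by apply: cvg_at_right_filter; exact: c.
  + by apply: cvg_at_left_filter; exact: c.
- by move=> x _; rewrite derive1E; have [_ ->] := derive_NexpRN x.
Qed.

Lemma eGammaS s : 0 < s -> eGamma (s + 1) = (s%:E * eGamma s)%E.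
Proof.
move=> s0.
have h : (\int[mu]_(t in J n) (f (s + 1) t)%:E)%E @[n --> \oo] -->
  (0%:E + s%:E * eGamma s)%E.
  apply: (@cvg_trans
    _ (((n.+1%:R^-1 `^ s * expR (- n.+1%:R^-1) -
    n.+1%:R `^ s * expR (- n.+1%:R))%:E +
    s%:E * \int[mu]_(t in J n) (f s t)%:E)%E @[n --> \oo])).
    apply: near_eq_cvg; near=> n; rewrite parts//; near: n;
      exact: nbhs_infty_gt.
  apply: cvgeD; first by [].
    apply: cvg_EFin; first by near=> n.
    rewrite -[X in _ --> X](subr0 (0 : R)).
    by apply: cvgB; [exact: cvg_at_zero|exact: cvg_at_infty].
  by apply: cvgeZl => //; exact: cvg_eGamma.
rewrite add0e in h.
by rewrite -(cvg_lim _ h)//; apply/esym/cvg_lim => //; exact: cvg_eGamma.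
Unshelve. all: by end_near. Qed.

Let eGamma_ge0 s : (0 <= eGamma s)%E.
Proof. by apply: integral_ge0 => x _; rewrite lee_fin f_ge0. Qed.

Let eGamma_nat_fin n : (eGamma n.+1%:R < +oo)%E.
Proof.
elim: n => [|n IH]; last first.
  rewrite -natr1 eGammaS// lte_mul_pinfty//; exact: ler0n.
have mpos : measurable (`]0%R, +oo[%classic : set R) by exact: measurable_itv.
apply: (@le_lt_trans _ _ 1%E); last exact: ltry.
have <- := @integral_exponential_pdf R 1 ltr01.
apply: (@le_trans _ _ (\int[mu]_(t in `]0%R, +oo[) (exponential_pdf 1 t)%:E)%E).
  rewrite le_eqVlt; apply/orP; left; apply/eqP; apply: eq_integral.
  move=> x; rewrite inE/= in_itv/= andbT => x0.
  by rewrite exponential_pdfE ?ltW// /f subrr powRr0 -mulN1r.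
apply: ge0_subset_integral => //.
- by apply/measurable_EFinP; exact: measurable_exponential_pdf.
- by move=> x _; rewrite lee_fin exponential_pdf_ge0.
Qed.

(** The functional equation carries finiteness from [s + 1] back to [s], so take [1 <= s]. Then
    [t^(s - 1) <= 1 + t^n] with [n] the integer part of [s], which bounds the integral by values at
    positive integers. *)
Lemma eGamma_fin_num s : 0 < s -> eGamma s \is a fin_num.
Proof.
move=> s0; rewrite ge0_fin_numE//.
wlog s1 : s s0 / 1 <= s => [hw|].
  have : (eGamma (s + 1) < +oo)%E by apply: hw; lra.
  rewrite eGammaS//; have := eGamma_ge0 s.
  case: (eGamma s) => [r _ _|_|]; [exact: ltry| |by rewrite leeNy_eq].
  by rewrite gt0_muley ?lte_fin.
have mpos : measurable (`]0%R, +oo[%classic : set R) by exact: measurable_itv.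
pose n := Num.truncn s.
apply: (@le_lt_trans _ _ (eGamma 1 + eGamma n.+1%:R)%E); last first.
  by rewrite lte_add_pinfty//; exact: (eGamma_nat_fin 0).
rewrite /eGamma -ge0_integralD//; last 4 first.
- by move=> x _; rewrite lee_fin f_ge0.
- exact: measurable_f.
- by move=> x _; rewrite lee_fin f_ge0.
- exact: measurable_f.
apply: ge0_le_integral => //.
- by move=> x _; rewrite lee_fin f_ge0.
- exact: measurable_f.
- by apply: emeasurable_funD; exact: measurable_f.
move=> x; rewrite /= in_itv/= andbT => x0.
rewrite -EFinD lee_fin /f -mulrDl ler_wpM2r ?expR_ge0// subrr powRr0.
case: (lerP x 1) => x1.
  rewrite (@le_trans _ _ 1)// ?lerDl ?powR_ge0//.
  by rewrite -[leRHS](powRr0 x) ger_powR ?x0//; lra.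
rewrite (@le_trans _ _ (x `^ (n.+1%:R - 1)))// ?lerDr//.
by rewrite ler_powR ?(ltW x1)// lerD2r ltW// truncnS_gt.
Qed.

(** For [1 <= s] the integrand is at least [expR (- 2)] on [[1, 2]]; the functional equation handles
    smaller [s]. *)
Lemma eGamma_gt0 s : 0 < s -> (0 < eGamma s)%E.
Proof.
move=> s0; wlog s1 : s s0 / 1 <= s => [hw|].
  have : (0 < eGamma (s + 1))%E by apply: hw; lra.
  rewrite eGammaS//; have := eGamma_ge0 s.
  by rewrite le_eqVlt => /predU1P[<-|//]; rewrite mule0 ltxx.
have m12 : measurable (`[1%R, 2%R]%classic : set R) by exact: measurable_itv.
have mpos : measurable (`]0%R, +oo[%classic : set R) by exact: measurable_itv.
apply: (@lt_le_trans _ _ (\int[mu]_(t in `[1%R, 2%R]) (expR (- 2))%:E)%E).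
  rewrite integral_cst//= lebesgue_measure_itv/= lte_fin ltr1n.
  by rewrite -EFinB -EFinM lte_fin mulr_gt0 ?expR_gt0//; lra.
apply: (@le_trans _ _ (\int[mu]_(t in `[1%R, 2%R]) (f s t)%:E)%E).
  apply: ge0_le_integral => //.
  - exact: measurable_f.
  - move=> x; rewrite /= in_itv/= => /andP[x1 x2].
    rewrite lee_fin -[leLHS]mul1r ler_pM ?expR_ge0//.
      by rewrite -[leLHS](powRr0 x) ler_powR//; lra.
    by rewrite ler_expR lerN2.
apply: ge0_subset_integral => //.
- exact: measurable_f.
- by move=> x _; rewrite lee_fin f_ge0.
- by move=> x; rewrite /= !in_itv/= => /andP[x1 _]; rewrite andbT; lra.
Qed.

Lemma GammaE s : Gamma s = fine (eGamma s). Proof. by []. Qed.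

Lemma Gamma_gt0 s : 0 < s -> 0 < Gamma s.
Proof.
by move=> s0; rewrite GammaE fine_gt0// eGamma_gt0//= -ge0_fin_numE//
  eGamma_fin_num.
Qed.

Lemma GammaS s : 0 < s -> Gamma (s + 1) = s * Gamma s.
Proof. by move=> s0; rewrite !GammaE eGammaS// fineM// eGamma_fin_num. Qed.

Lemma Gamma_poch s n : 0 < s -> Gamma (s + n%:R) = Gamma s * poch s n.
Proof.
move=> s0; elim: n => [|n IH]; first by rewrite addr0 /poch big_ord0 mulr1.
rewrite -natr1 addrA GammaS ?ltr_wpDr// IH /poch big_ord_recr/=; ring.
Qed.

End GammaFunction.

(** * Absolutely convergent series *)

Section AbsoluteSums.
Context {R : realType}.
Implicit Types (u v : nat -> R) (a b c r : R).

(** Absolute convergence travels with the value, as biorthogonality over the naturals asserts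
    both. *)
Definition abs_sum u a := cvgn [normed series u] /\ series u @ \oo --> a.

Lemma abs_sum_lim u a : abs_sum u a -> limn (series u) = a.
Proof. by move=> [_ h]; exact: cvg_lim. Qed.

Lemma abs_sum_unique u a b : abs_sum u a -> abs_sum u b -> a = b.
Proof. by move=> /abs_sum_lim <- /abs_sum_lim. Qed.

Lemma abs_sum_limn u : cvgn [normed series u] -> abs_sum u (limn (series u)).
Proof. by move=> h; split => //; exact: normed_cvg. Qed.

Lemma eq_abs_sum u v a : u =1 v -> abs_sum u a -> abs_sum v a.
Proof. by move=> /funext ->. Qed.

Lemma abs_sum_le u v : (forall n, `|u n| <= v n) -> cvgn (series v) ->
  cvgn [normed series u].
Proof.
move=> uv; apply: series_le_cvg => n //=; first exact: le_trans (uv n).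
Qed.

Lemma abs_sum0 : abs_sum (fun=> 0) 0.
Proof.
have e : series (fun=> 0 : R) = cst 0.
  by apply/funext => n; rewrite /series/= big1_eq.
split; last by rewrite e; exact: cvg_cst.
rewrite (_ : [normed series (fun=> 0 : R)] = series (fun=> 0)) ?e.
  exact: is_cvg_cst.
by apply/funext => n; apply: eq_bigr => i _; rewrite normr0.
Qed.

Lemma abs_sumD u v a b : abs_sum u a -> abs_sum v b ->
  abs_sum (fun n => u n + v n) (a + b).
Proof.
move=> [cu ua] [cv vb]; split; last first.
  rewrite (_ : series _ = (fun n => series u n + series v n)).
    exact: cvgD ua vb.
  by apply/funext => n; rewrite /series/= big_split.
apply: (@abs_sum_le _ (fun n => `|u n| + `|v n|)) => [n|];
  first exact: ler_normD.
exact: is_cvg_seriesD.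
Qed.

Lemma abs_sumZ u a c : abs_sum u a -> abs_sum (fun n => c * u n) (c * a).
Proof.
move=> [cu ua]; split; last first.
  rewrite (_ : series _ = (fun n => c * series u n)).
    by apply: cvgM ua; exact: cvg_cst.
  by apply/funext => n; rewrite /series/= mulr_sumr.
apply: (@abs_sum_le _ (fun n => `|c| * `|u n|)) => [n|];
  first by rewrite normrM.
exact: (@is_cvg_seriesZ _ _ `|c|).
Qed.

Lemma abs_sum_sum (I : Type) (l : seq I) (u : I -> nat -> R) (a : I -> R) :
  (forall i, abs_sum (u i) (a i)) ->
  abs_sum (fun n => \sum_(i <- l) u i n) (\sum_(i <- l) a i).
Proof.
move=> h; elim: l => [|i l IH].
  by rewrite big_nil; apply: eq_abs_sum abs_sum0 => n; rewrite big_nil.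
rewrite big_cons; apply: eq_abs_sum (abs_sumD (h i) IH) => n.
by rewrite big_cons.
Qed.

Lemma abs_sum_finite u N : (forall n, (N <= n)%N -> u n = 0) ->
  abs_sum u (\sum_(n < N) u n).
Proof.
move=> h.
have key v : (forall n, (N <= n)%N -> v n = 0) -> series v @ \oo -->
  \sum_(n < N) v n.
  move=> hv; apply: cvg_near_cst; near=> n.
  have Nn : (N <= n)%N by near: n; exact: nbhs_infty_ge.
  rewrite /series/= big_mkord -[n](subnKC Nn) big_split_ord/=.
  by rewrite [X in _ + X]big1 ?addr0// => i _; rewrite hv ?leq_addr.
split; last exact: key.
by apply/cvg_ex; eexists; apply: key => n Nn; rewrite /= h// normr0.
Unshelve. all: by end_near. Qed.

Lemma series_succ u n : series u n.+1 = u 0%N + series (u \o S) n.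
Proof. by rewrite /series/= big_nat_recl. Qed.

(** Summation by parts on the naturals, with boundary term [u 0 = 0]; this is the source of
    adjointness. *)
Lemma abs_sum_shift u a b : u 0%N = 0 -> abs_sum u a ->
  abs_sum (u \o S) b -> a = b.
Proof.
move=> u0 [_ ua] [_ ub]; have : series u (n + 1)%N @[n --> \oo] -->
  a by apply: cvg_comp ua; exact: cvg_addnr.
have -> : (fun n => series u (n + 1)%N) = series (u \o S).
  by apply/funext => n; rewrite addn1 series_succ u0 add0r.
by move=> h; rewrite -(cvg_lim _ h)// (cvg_lim _ ub).
Qed.

Lemma ratio_test u r N : 0 < r -> r < 1 ->
  (forall n, (N <= n)%N -> `|u n.+1| <= r * `|u n|) -> cvgn [normed series u].
Proof.
(* [C] dominates [|u k| / r^k] for all [k <= N] at once, so the bound [C r^n] holds on the initial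
   segment and the ratio condition propagates it. *)
move=> r0 r1 h; pose C := \sum_(k < N.+1) `|u k| / r ^+ k.
apply: (@abs_sum_le _ (geometric C r)) => [n|]; last first.
  by apply: is_cvg_geometric_series; rewrite gtr0_norm.
rewrite /geometric/=; elim: n => [|n IH].
  rewrite expr0 mulr1 /C big_ord_recl/= expr0 divr1 lerDl.
  by apply: sumr_ge0 => i _; rewrite divr_ge0// exprn_ge0// ltW.
case: (ltnP n N) => nN; last first.
  by rewrite (le_trans (h _ nN))// exprS mulrCA ler_wpM2l// ltW.
have nN1 : (n.+1 < N.+1)%N by [].
rewrite -ler_pdivrMr ?exprn_gt0// /C (bigD1 (Ordinal nN1))//= lerDl.
by apply: sumr_ge0 => i _; rewrite divr_ge0// exprn_ge0// ltW.
Qed.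

End AbsoluteSums.

(** * Moments and orthogonality *)

Section Weights.
Context {R : realType} (alpha sigma s : R).
Notation phi := (phi alpha sigma).
Notation dual := (dual alpha sigma).
Notation dual_coef := (dual_coef alpha sigma).

Definition weight (x : nat) : R := phi x * s ^+ x / x`!%:R.

Lemma weightS x : x.+1%:R * weight x.+1 = s * (alpha + sigma * x%:R) * weight x.
Proof.
rewrite /weight phiS exprS factS natrM; have : x`!%:R != 0 :> R := fact_neq0 x.
have : x.+1%:R != 0 :> R by rewrite pnatr_eq0.
by move: x.+1%:R => x1 ? ?; field; apply/andP.
Qed.

Hypotheses (s0 : s != 0) (ss : 1 - sigma * s != 0).

(* Slack in the parameter, which absorbs the factors [x^_m x^_n]. *)
Variable e : R.
Hypothesis e0 : 0 < e.
Hypothesis weight_cvg :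
  cvgn [normed series (fun x => phi x * (s * (1 + e) ^+ 2) ^+ x / x`!%:R)].

(** ['C(x, m) e^m] is a single term of the binomial expansion of [(1 + e)^x]. *)
Lemma ffact_le_exp m x : (x ^_ m)%:R <= m`!%:R / e ^+ m * (1 + e) ^+ x.
Proof.
rewrite -bin_ffact natrM mulrC -mulrA ler_wpM2l// ler_pdivlMl ?exprn_gt0//.
case: (leqP m x) => mx; last first.
  by rewrite bin_small// mulr0 exprn_ge0// addr_ge0// ltW.
have mx1 : (m < x.+1)%N by [].
rewrite exprDn (bigD1 (Ordinal mx1))//= expr1n mul1r [leLHS]mulr_natr lerDl.
by apply: sumr_ge0 => i _; rewrite mulrn_wge0// mulr_ge0// exprn_ge0// ltW.
Qed.

(** Each of the two falling factorials costs a factor [(1 + e)^x], hence the square in the slack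
    hypothesis. *)
Lemma moment_cvg m n :
  cvgn [normed series (fun x => (x ^_ m)%:R * (x ^_ n)%:R * weight x)].
Proof.
pose C k : R := k`!%:R / e ^+ k.
have C0 k : 0 <= C k by rewrite divr_ge0// exprn_ge0// ltW.
have e1 : 0 <= 1 + e by rewrite addr_ge0// ltW.
apply: (@abs_sum_le
  _ _ (fun x => (C m * C n) * `|phi x * (s * (1 + e) ^+ 2) ^+ x / x`!%:R|)) =>
  [x|]; last first.
  exact: (@is_cvg_seriesZ _ _ (C m * C n)).
rewrite [leRHS](_ : _ =
  (C m * (1 + e) ^+ x) * (C n * (1 + e) ^+ x) * `|weight x|).
  rewrite normrM ler_wpM2r// normrM !ger0_norm//.
  by rewrite ler_pM// ffact_le_exp.
rewrite /weight !normrM !normrX normrM normrX (ger0_norm e1) exprMn -exprM mul2n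
  -addnn exprD.
by ring.
Qed.

Definition moment m n : R :=
  limn (series (fun x => (x ^_ m)%:R * (x ^_ n)%:R * weight x)).

Lemma moment_abs_sum m n :
  abs_sum (fun x => (x ^_ m)%:R * (x ^_ n)%:R * weight x) (moment m n).
Proof. by apply: abs_sum_limn; exact: moment_cvg. Qed.

Lemma momentC m n : moment m n = moment n m.
Proof.
apply: abs_sum_unique (moment_abs_sum m n) _.
by apply: eq_abs_sum (moment_abs_sum n m) => x; rewrite [_ * (x ^_ m)%:R]mulrC.
Qed.

Lemma moment_shift m n :
  moment m n.+1 - moment m.+1 n = (m%:R - n%:R) * moment m n.
Proof.
apply: abs_sum_unique (abs_sumZ (m%:R - n%:R) (moment_abs_sum m n)).
rewrite -[moment m.+1 n]mul1r -mulNr.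
apply: eq_abs_sum
  (abs_sumD (moment_abs_sum m n.+1) (abs_sumZ (-1) (moment_abs_sum m.+1 n))) =>
  x.
by rewrite !ffactSr_natr; ring.
Qed.

(** Write [x^_n.+1 = x x.-1^_n], shift [x], and apply [weightS]; the product
    [(alpha + sigma x) x.+1^_m] is then expanded in falling factorials of [x]. *)
Lemma moment_adj m n : moment m n.+1 =
  s * (sigma * moment m.+1 n + (alpha + 2 * sigma * m%:R) * moment m n +
       m%:R * (alpha + sigma * (m%:R - 1)) * moment m.-1 n).
Proof.
apply: (@abs_sum_shift _ _ _ _ _ (moment_abs_sum m n.+1)).
  by rewrite ffact0n mulr0 mul0r.
apply: (eq_abs_sum _ (abs_sumZ s (abs_sumD (abs_sumD
   (abs_sumZ sigma (moment_abs_sum m.+1 n))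
   (abs_sumZ (alpha + 2 * sigma * m%:R) (moment_abs_sum m n)))
   (abs_sumZ (m%:R * (alpha + sigma * (m%:R - 1))) (moment_abs_sum m.-1 n)))))
     => x /=.
rewrite (ffactS_natr x.+1)/= [_ * (x ^_ n)%:R]mulrC.
rewrite [RHS](_ : _ = (x.+1 ^_ m)%:R * (x ^_ n)%:R * (x.+1%:R * weight x.+1));
  last by ring.
rewrite weightS ffact_succ_natr ffactSr_natr; case: m => [|m] /=; first by ring.
by rewrite -natr1 !ffactSr_natr; ring.
Qed.

Lemma moment00 a : abs_sum weight a -> moment 0 0 = a.
Proof.
move=> h; apply: abs_sum_unique (moment_abs_sum 0 0) _.
by apply: eq_abs_sum h => x; rewrite !ffactn0 !mul1r.
Qed.

Lemma moment_dual_abs_sum Z m n : abs_sum weight Z -> phi m != 0 ->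
  abs_sum (fun x => (x ^_ m)%:R * (x ^_ n)%:R * weight x)
    (Z * phi m * phi n * (s / (1 - sigma * s)) ^+ (m + n) * dual s^-1 m n).
Proof.
move=> hZ pm; rewrite -(moment00 hZ).
rewrite -(moment_dual s0 ss momentC moment_shift moment_adj)//.
exact: moment_abs_sum.
Qed.

Lemma dual_orthogonal Z m n : abs_sum weight Z -> phi m != 0 -> phi n != 0 ->
  abs_sum (fun x =>
    dual (sigma - s^-1) x m * dual (sigma - s^-1) x n * weight x)
    ((m == n)%:R * (Z * m`!%:R / (phi m * s ^+ m))).
Proof.
move=> hZ pm pn; rewrite -(moment00 hZ).
rewrite -(dual_orthogonal_moments s0 ss momentC moment_shift moment_adj)//.
pose t := sigma - s^-1.
(* For a fixed second argument the kernel is a finite combination of falling factorials of [x], so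
   the pairing is a finite double sum of moments. *)
apply: (@eq_abs_sum _ (fun x => \sum_(i < m.+1) \sum_(z < n.+1)
    dual_coef t i * (m ^_ i)%:R * (dual_coef t z * (n ^_ z)%:R *
      ((x ^_ i)%:R * (x ^_ z)%:R * weight x)))) => [x|]; last first.
  apply: abs_sum_sum => i; apply: abs_sum_sum => z.
  by do 2 apply: abs_sumZ; exact: moment_abs_sum.
rewrite (@dualE _ _ _ _ _ _ m.+1) ?gtn_min ?leqnn ?orbT//.
rewrite (@dualE _ _ _ _ _ _ n.+1) ?gtn_min ?leqnn ?orbT//.
rewrite big_distrlr/= mulr_suml; apply: eq_bigr => i _.
rewrite mulr_suml; apply: eq_bigr => z _; ring.
Qed.

End Weights.

(** * Self-duality on a bond *)

Section BondIdentity.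
Context {R : realType}.
Implicit Types (S : pred nat) (c d : nat -> nat -> R).

(* Contribution to the generator of one particle hopping from the first to the
   second site of a bond, applied to [d(., v1) d(., v2)]. *)
Definition hop c d (u1 u2 v1 v2 : nat) : R :=
  c u1 u2 * (d u1.-1 v1 * d u2.+1 v2 - d u1 v1 * d u2 v2).

Definition bond_identity S c d := forall x1 x2 y1 y2, S x1 -> S x2 -> S y1 ->
  S y2 ->
  hop c d x1 x2 y1 y2 + hop c d x2 x1 y2 y1 =
  hop c (fun y x => d x y) y1 y2 x1 x2 + hop c (fun y x => d x y) y2 y1 x2 x1.

(** Sites off the bond contribute a common factor [P] unchanged by moves along the bond;
    irreflexivity makes the two endpoints distinct. *)
Lemma bond_identity_self_duality S c d : bond_identity S c d ->
  self_duality S c d.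
Proof.
move=> bondP V e _ e_irr x y Sx Sy; rewrite /generator.
apply: eq_bigr => i _; apply: eq_bigr => l /andP[eil _].
have li : l != i by apply/eqP => li; rewrite li e_irr in eil.
pose P := \prod_(v | (v != i) && (v != l)) d (x v) (y v).
have split_prod (x' y' : {ffun V -> nat}) :
    (forall v, v != i -> v != l -> x' v = x v) ->
      (forall v, v != i -> v != l -> y' v = y v) ->
    prod_duality d x' y' = d (x' i) (y' i) * d (x' l) (y' l) * P.
  move=> hx hy; rewrite /prod_duality (bigD1 i)//= (bigD1 l)//= mulrA;
    congr (_ * _).
  by apply: eq_bigr => v /andP[vi vl]; rewrite hx ?hy.
have moveE (z : {ffun V -> nat}) (a b : V) : b != a ->
    [/\ move z a b a = (z a).-1, move z a b b = (z b).+1 &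
        forall v, v != a -> v != b -> move z a b v = z v].
  move=> ba; split; rewrite ?ffunE ?eqxx ?(negbTE ba)// => v va vb.
  by rewrite ffunE (negbTE va) (negbTE vb).
have il : i != l by rewrite eq_sym.
rewrite /bond_generator.
have [xa xb xv] := moveE x _ _ li; have [xa' xb' xv'] := moveE x _ _ il.
have [ya yb yv] := moveE y _ _ li; have [ya' yb' yv'] := moveE y _ _ il.
rewrite !split_prod//; try by move=> v ? ?; rewrite (xv, yv, xv', yv').
rewrite xa xb xa' xb' ya yb ya' yb'.
have := bondP _ _ _ _ (Sx i) (Sx l) (Sy i) (Sy l); rewrite /hop => h.
transitivity ((c (x i) (x l) *
  (d (x i).-1 (y i) * d (x l).+1 (y l) - d (x i) (y i) * d (x l) (y l)) +
  c (x l) (x i) *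
    (d (x l).-1 (y l) * d (x i).+1 (y i) - d (x l) (y l) * d (x i) (y i))) * P).
  by ring.
by rewrite h; ring.
Qed.

(** A hop preserves the number of particles, so the total exponent of [b] is the same before and
    after it. At [u1 = 0] the truncated predecessor breaks this count, but the rate is zero. *)
Lemma hop_scale c d d' (C b : R) u1 u2 v1 v2 : (forall v, c 0%N v = 0) ->
  (forall x y, d' x y = b ^+ (x + y) * C * d x y) ->
  hop c d' u1 u2 v1 v2 =
    b ^+ (u1 + v1 + (u2 + v2)) * C ^+ 2 * hop c d u1 u2 v1 v2.
Proof.
move=> c0 d'E; rewrite /hop !d'E.
case: u1 => [|u1] /=; first by rewrite c0 !mul0r mulr0.
by rewrite !addSn !exprS !exprD; ring.
Qed.

Lemma bond_identity_scale S c d d' (C b : R) : (forall v, c 0%N v = 0) ->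
  (forall x y, d' x y = b ^+ (x + y) * C * d x y) ->
  bond_identity S c d -> bond_identity S c d'.
Proof.
move=> c0 d'E bondP x1 x2 y1 y2 S1 S2 T1 T2.
have d'TE y x : (fun y x => d' x y) y x =
  b ^+ (y + x) * C * (fun y x => d x y) y x.
  by rewrite d'E addnC.
rewrite !(hop_scale _ _ _ _ c0 d'E) !(hop_scale _ _ _ _ c0 d'TE).
rewrite [(x2 + y2 + _)%N]addnC -mulrDr bondP// (addnC y1) (addnC y2).
by rewrite [X in _ = _ + b ^+ X * _ * _]addnC mulrDr.
Qed.

(** Agreement on [S] suffices because a hop leaving [S] has rate zero. *)
Lemma eq_hop S c d d' u1 u2 v1 v2 :
  (forall u, S u -> S u.-1) ->
    (forall u v, S u -> S v -> S v.+1 \/ c u v = 0) ->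
  (forall x y, S x -> S y -> d x y = d' x y) ->
  S u1 -> S u2 -> S v1 -> S v2 -> hop c d u1 u2 v1 v2 = hop c d' u1 u2 v1 v2.
Proof.
move=> Sp Sc dd' S1 S2 T1 T2; rewrite /hop.
case: (Sc _ _ S1 S2) => [S3|->]; last by rewrite !mul0r.
by rewrite !dd' ?Sp.
Qed.

Lemma eq_bond_identity S c d d' :
  (forall u, S u -> S u.-1) ->
    (forall u v, S u -> S v -> S v.+1 \/ c u v = 0) ->
  (forall x y, S x -> S y -> d x y = d' x y) ->
  bond_identity S c d -> bond_identity S c d'.
Proof.
move=> Sp Sc dd' bondP x1 x2 y1 y2 S1 S2 T1 T2.
have := bondP x1 x2 y1 y2 S1 S2 T1 T2.
rewrite !(eq_hop Sp Sc dd')//.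
by rewrite !(@eq_hop S c (fun y x => d x y) (fun y x => d' x y))// => y x Sy Sx;
  exact: dd'.
Qed.

End BondIdentity.

(** * Pairings and biorthogonality for general [alpha] and [sigma] *)

Section GenericPairings.
Context {R : realType} (alpha sigma : R).
Notation phi := (phi alpha sigma).
Notation dual := (dual alpha sigma).
Notation dual_coef := (dual_coef alpha sigma).
Notation weight := (weight alpha sigma).
Implicit Types (c s t b C Z : R).

(** Common form of the classical duality functions: [c = - 1/r] for inclusion and independent
    walkers, [c = - (1 - r)/r] for exclusion. *)
Definition classical c (x y : nat) : R := (x ^_ y)%:R / phi y * c ^+ y.

Lemma classical_pairing c s x n z : phi z != 0 ->
  classical c x z * classical c n z * weight s z =
  dual_coef (c ^+ 2 * s) z * (x ^_ z)%:R * (n ^_ z)%:R.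
Proof.
move=> pz; rewrite /classical /weight /dual_coef exprMn -exprM mulnC exprM
  expr2.
by have z0 : z`!%:R != 0 :> R := fact_neq0 z; field; rewrite z0.
Qed.

Lemma poch_oppn (x m : nat) : poch (- x%:R : R) m = (-1) ^+ m * (x ^_ m)%:R.
Proof.
elim: m => [|m IH]; first by rewrite /poch big_ord0 ffactn0 mulr1.
by rewrite /poch big_ord_recr/= -/(poch _ _) IH ffactSr_natr exprS; ring.
Qed.

Lemma dual_abs_sum t x n :
  abs_sum (fun z => dual_coef t z * (x ^_ z)%:R * (n ^_ z)%:R) (dual t x n).
Proof.
apply: abs_sum_finite => z h.
have xz : (x < z)%N by apply: leq_trans h; rewrite ltnS leq_addr.
by rewrite (ffact_small xz) mulr0 mul0r.
Qed.

(** The signs of the two upper parameters cancel; [r] carries the sign of the lower one, [1] for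
    [2k] and [-1] for [- N]. *)
Lemma F21_dual (b r z : R) x n : (forall m, poch b m = r ^+ m * phi m) ->
  F21 (- x%:R) (- n%:R) b z = dual (z / r) x n.
Proof.
move=> pb; apply: abs_sum_lim; apply: eq_abs_sum (dual_abs_sum _ x n) => m.
rewrite !big_cons !big_nil !mulr1 !poch_oppn pb /dual_coef exprMn exprVn !invfM.
transitivity ((-1) ^+ m * (-1) ^+ m *
  (z ^+ m * (r ^+ m)^-1 * ((phi m)^-1 * (m`!%:R)^-1) * (x ^_ m)%:R *
  (n ^_ m)%:R)).
  by rewrite -expr2 sqrr_sign mul1r.
by ring.
Qed.

Lemma F20_dual (z : R) x n : (forall m, phi m = 1) ->
  F20 (- x%:R) (- n%:R) z = dual z x n.
Proof.
move=> p1; apply: abs_sum_lim; apply: eq_abs_sum (dual_abs_sum _ x n) => m.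
rewrite !big_cons !big_nil !mulr1 !poch_oppn /dual_coef p1 divr1 mul1r.
transitivity ((-1) ^+ m * (-1) ^+ m *
  (z ^+ m / m`!%:R * (x ^_ m)%:R * (n ^_ m)%:R)).
  by rewrite -expr2 sqrr_sign mul1r.
by ring.
Qed.

Section Summable.
Variables (s Z e : R).
Hypotheses (s0 : s != 0) (ss : 1 - sigma * s != 0) (e0 : 0 < e).
Hypothesis weight_cvg : cvgn [normed series (weight (s * (1 + e) ^+ 2))].
Hypothesis hZ : abs_sum (weight s) Z.

Lemma classical_transpose_abs_sum c x n : phi x != 0 -> phi n != 0 ->
  abs_sum (fun z => classical c z x * classical c z n * weight s z)
    ((c * (s / (1 - sigma * s))) ^+ (x + n) * Z * dual s^-1 x n).
Proof.
move=> px pn.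
(* As functions of [z] the transposed classical functions are constant multiples of falling
   factorials; [K] collects the constants. *)
pose K := c ^+ (x + n) / (phi x * phi n).
have := abs_sumZ K (moment_dual_abs_sum s0 ss e0 weight_cvg n hZ px).
rewrite [K * _](_ : _ =
  (c * (s / (1 - sigma * s))) ^+ (x + n) * Z * dual s^-1 x n).
  by apply: eq_abs_sum => z; rewrite /K /classical exprD; field; rewrite pn.
by rewrite /K [in RHS]exprMn; move: (_ ^+ _) => ?; move: (_ ^+ _) => ?; field;
  rewrite pn.
Qed.

(** [C] cancels the total mass [Z] of the weight at [s = b p], and on the diagonal [b^m / s^m]
    restores [p^-m]. *)
Lemma dual_biorthogonal b p C m n : b * p = s -> C * Z = 1 -> phi m != 0 ->
  phi n != 0 ->
  abs_sum (fun x => dual (sigma - s^-1) x m *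
      (b ^+ (n + x) * C * dual (sigma - s^-1) x n) * weight p x)
    ((m == n)%:R * (weight p m)^-1).
Proof.
move=> bp CZ pm pn.
have := abs_sumZ (C * b ^+ n) (dual_orthogonal s0 ss e0 weight_cvg hZ pm pn).
rewrite [_ * (_ * _)](_ : _ = (m == n)%:R * (weight p m)^-1).
  by apply: eq_abs_sum => x; rewrite /weight -bp exprMn exprD; ring.
case: eqP => [<-|_]; last by rewrite !mul0r mulr0.
have := expf_neq0 m s0; rewrite -bp exprMn mulf_eq0 negb_or => /andP[bm pm'].
rewrite !mul1r /weight; have m0 : m`!%:R != 0 :> R := fact_neq0 m.
transitivity (C * Z * (m`!%:R / (phi m * p ^+ m))); first by field;
  rewrite pm' bm pm.
by rewrite CZ; field; rewrite pm' m0 pm.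
Qed.

End Summable.

End GenericPairings.

(** * Normalizing constants *)

Section NegativeBinomial.
Context {R : realType} (alpha : R).
Hypothesis alpha0 : 0 < alpha.
Notation weight := (weight alpha 1).
Notation phi := (phi alpha 1).

Lemma phi_gt0 n : 0 < phi n.
Proof. by apply: prodr_gt0 => i _; rewrite mul1r ltr_wpDr. Qed.

Lemma negative_binomial_cvg (s : R) : `|s| < 1 ->
  cvgn [normed series (weight s)].
Proof.
move=> s1; pose r := (`|s| + 1) / 2.
have r0 : `|s| < r by rewrite /r; lra.
have r1 : r < 1 by rewrite /r; lra.
have rs : 0 < r - `|s| by lra.
(* Beyond this threshold [|s| (alpha + n) < r n], so successive terms shrink at least by [r]. *)
pose N := (Num.truncn (`|s| * alpha / (r - `|s|))).+1.
apply: (@ratio_test _ _ r N) => //; first exact: le_lt_trans r0.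
move=> n Nn; have n1 : 0 < n.+1%:R :> R by [].
rewrite -(ler_pM2l n1) -[n.+1%:R in leLHS]ger0_norm// -normrM weightS !normrM.
have -> : `|alpha + 1 * n%:R| = alpha + n%:R.
  by rewrite mul1r ger0_norm// addr_ge0// ltW.
rewrite [leRHS]mulrA ler_wpM2r// -natr1.
have : `|s| * alpha / (r - `|s|) <
  n%:R by rewrite (lt_le_trans (truncnS_gt _))// ler_nat.
rewrite ltr_pdivrMr// => h; have := normr_ge0 s; nra.
Qed.

Lemma negative_binomial_summable (s : R) : `|s| < 1 ->
  exists2 e : R, 0 < e & cvgn [normed series (weight (s * (1 + e) ^+ 2))].
Proof.
move=> s1; have s0 := normr_ge0 s; exists ((1 - `|s|) / 3); first lra.
apply: negative_binomial_cvg; rewrite normrM [X in _ * X]ger0_norm ?sqr_ge0//.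
set a := `|s| in s1 s0 *.
rewrite -subr_gt0.
(* The choice of slack makes [1 - a] factor out, with a cofactor positive for [0 <= a < 1]. *)
have -> : 1 - a * (1 + (1 - a) / 3) ^+ 2 =
  (1 - a) * (9 - 7 * a + a ^+ 2) / 9 by field.
by rewrite divr_gt0// mulr_gt0 ?subr_gt0//; nra.
Qed.

End NegativeBinomial.

(* The sum [F] of the series solves [(1 - x) F' = a F], so that
   [(1 - x)^a F(x)] is constant. *)
Section NegativeBinomialSum.
Context {R : realType}.
Implicit Types (a s : R).

Let coef a n : R := phi a 1 n / n`!%:R.

Let pseriesE a s : pseries (coef a) s = series (weight a 1 s).
Proof. by apply/funext => n; apply: eq_bigr => i _;
  rewrite /coef /weight mulrAC. Qed.

Let phi_shift a n : phi a 1 n.+1 = a * phi (a + 1) 1 n.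
Proof.
rewrite /phi big_ord_recl mulr0 addr0; congr (_ * _); apply: eq_bigr => i _.
by rewrite lift0 -natr1; ring.
Qed.

Let diffs_coef a n : pseries_diffs (coef a) n = a * coef (a + 1) n.
Proof.
rewrite /pseries_diffs /coef phi_shift factS natrM; have n0 :
  n`!%:R != 0 :> R := fact_neq0 n.
have : n.+1%:R != 0 :> R by rewrite pnatr_eq0.
by move: n.+1%:R => ? ?; field; apply/andP.
Qed.

Let abs_sum_weight a s : 0 < a -> `|s| < 1 ->
  abs_sum (weight a 1 s) (limn (series (weight a 1 s))).
Proof. by move=> a0 s1; apply: abs_sum_limn; exact: negative_binomial_cvg. Qed.

(** Since [a w_(a+1)(n) = (a + n) w_a(n)], the difference [a w_(a+1) - a w_a] is [n w_a(n)]; it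
    vanishes at [0], and shifting it gives [s a w_(a+1)]. *)
Let sum_succ a s : 0 < a -> `|s| < 1 ->
  (1 - s) * limn (series (weight (a + 1) 1 s)) = limn (series (weight a 1 s)).
Proof.
move=> a0 s1; have a1 : 0 < a + 1 by lra.
have h := abs_sum_weight a0 s1; have h1 := abs_sum_weight a1 s1.
have aw n : a * weight (a + 1) 1 s n = (a + n%:R) * weight a 1 s n.
  by rewrite /weight !mulrA -phi_shift phiS mul1r [_ * phi _ _ _]mulrC.
have u := abs_sumD (abs_sumZ a h1) (abs_sumZ (- a) h).
have v := abs_sumZ s (abs_sumZ a h1).
have := @abs_sum_shift _ _ _ _ _ u;
  move/(_ (s * (a * limn (series (weight (a + 1) 1 s))))).
rewrite /= aw addr0 => H.
apply: (mulfI (lt0r_neq0 a0)); have {}H := H _ _.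
rewrite mulrA mulrBr mulr1 mulrBl.
have {}H : a * limn (series (weight (a + 1) 1 s)) + -
  a * limn (series (weight a 1 s)) =
   s * (a * limn (series (weight (a + 1) 1 s))).
  apply: H; first by ring.
  apply: eq_abs_sum v => n /=; rewrite !aw.
  transitivity (n.+1%:R * weight a 1 s n.+1); last by ring.
  by rewrite weightS mul1r mulrA.
lra.
Qed.

Let pseries_diffsE a s :
  pseries (pseries_diffs (coef a)) s =
    series (fun n => a * weight (a + 1) 1 s n).
Proof.
apply/funext => n; apply: eq_bigr => i _.
by rewrite /= diffs_coef /coef /weight; ring.
Qed.

Let pseries_diffs2E a s : pseries (pseries_diffs (pseries_diffs (coef a))) s =
  series (fun n => a * ((a + 1) * weight (a + 1 + 1) 1 s n)).
Proof.
apply/funext => n; apply: eq_bigr => i _.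
rewrite /=; have -> : pseries_diffs (pseries_diffs (coef a)) i =
  a * ((a + 1) * coef (a + 1 + 1) i).
  by rewrite -[(a + 1) * _]diffs_coef [X in a * X]/pseries_diffs [RHS]mulrCA
    -diffs_coef.
by rewrite /coef /weight; ring.
Qed.

Lemma negative_binomial_sum a s : 0 < a -> `|s| < 1 ->
  abs_sum (weight a 1 s) ((1 - s) `^ (- a)).
Proof.
move=> a0 s1; have a1 : 0 < a + 1 by lra.
have a2 : 0 < a + 1 + 1 by lra.
pose F (x : R) : R := limn (pseries (coef a) x).
have FE x : F x = limn (series (weight a 1 x)) by rewrite /F pseriesE.
have dF (x : R) : `|x| < 1 ->
    is_derive x (1 : R) F (a * limn (series (weight (a + 1) 1 x))).
  move=> x1; rewrite -(abs_sum_lim (abs_sumZ a (abs_sum_weight a1 x1)))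
    -pseries_diffsE.
  (* Termwise differentiation at [x] requires the series and its first two formal derivatives to
     converge at some point [K] with [|x| < |K|]; the midpoint to [1] is still inside the disc. *)
  pose K := (`|x| + 1) / 2.
  have x0 := normr_ge0 x; have K0 : 0 <= K by rewrite /K; lra.
  have K1 : `|K| < 1 by rewrite ger0_norm// /K; lra.
  apply: (@pseries_snd_diffs _ _ K).
  - by rewrite pseriesE; exact: normed_cvg (negative_binomial_cvg a0 K1).
  - by rewrite pseries_diffsE;
      exact: normed_cvg (abs_sumZ a (abs_sum_weight a1 K1)).1.
  - rewrite pseries_diffs2E.
    exact: normed_cvg (abs_sumZ a (abs_sumZ (a + 1) (abs_sum_weight a2 K1))).1.
  - by rewrite (ger0_norm K0) /K; lra.
pose G (x : R) : R := (1 - x) `^ a * F x.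
have dG (x : R) : `|x| < 1 -> is_derive x (1 : R) G 0.
  move=> x1; have x1' : 0 < 1 - x by move: x1; rewrite ltr_norml; lra.
  have d1 : is_derive x (1 : R) (fun y : R => 1 - y) (-1).
    have := is_deriveB (is_derive_cst (1 : R) x (1 : R))
      (is_derive_id x (1 : R)).
    by rewrite sub0r.
  have d2 := @is_derive1_comp R (@powR R ^~ a) (fun y => 1 - y) x
    _ _ (is_derive1_powR a x1') d1.
  have := is_deriveM d2 (dF _ x1); move/is_derive_eq; apply.
  (* Writing [(1 - x)^a = (1 - x) (1 - x)^(a - 1)] and [F] through its successor series makes the
     two terms of the product rule cancel. *)
  rewrite /= FE -(sum_succ a0 x1) -(mulr_powRB1 (ltW x1') a0).
  by rewrite /GRing.scale/=; ring.
have G0 : G 0 = 1.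
  rewrite /G FE subr0 powR1 mul1r.
  rewrite (abs_sum_lim (@abs_sum_finite _ _ 1 _)) => [|[|n]//].
    by rewrite big_ord1 /weight phi0 expr0 fact0 mul1r divr1.
  by rewrite /weight expr0n/= mulr0 mul0r.
have G_cst (x y : R) : `|x| < 1 -> `|y| < 1 -> x <= y -> G x = G y.
  move=> x1 y1 xy.
  have bnd (z : R) : x <= z <= y -> `|z| < 1.
    by move: x1 y1; rewrite !ltr_norml; lra.
  have [z||c _] := @MVT_segment R G (fun=> 0) x y xy.
  - by rewrite in_itv/= => /andP[xz zy]; apply: dG; apply: bnd; rewrite !ltW.
  - apply: derivable_within_continuous => z; rewrite in_itv/= => /bnd z1.
    by have [] := dG _ z1.
  - by rewrite mul0r => /eqP; rewrite subr_eq0 => /eqP.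
have GE : G s = G 0.
  have n0 : `|0 : R| < 1 by rewrite normr0.
  by case: (leP s 0) => [|/ltW] s0; [|apply/esym]; apply: G_cst.
have s1' : 0 < 1 - s by move: s1; rewrite ltr_norml; lra.
rewrite powRN; have -> : ((1 - s) `^ a)^-1 = F s.
  move: GE; rewrite G0 /G => GE.
  by apply: (mulfI (lt0r_neq0 (powR_gt0 a s1')));
    rewrite GE mulfV// lt0r_neq0// powR_gt0.
by rewrite FE; exact: abs_sum_weight.
Qed.

End NegativeBinomialSum.

(** * Exponential and binomial totals *)

Lemma exponential_summable {R : realType} (s : R) :
  exists2 e : R, 0 < e & cvgn [normed series (weight 1 0 (s * (1 + e) ^+ 2))].
Proof.
exists 1 => //.
have -> : weight 1 0 (s * (1 + 1) ^+ 2) = exp_coeff (s * (1 + 1) ^+ 2).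
  apply/funext => n; rewrite /weight /exp_coeff /phi big1 ?mul1r// => i _.
  by rewrite mul0r addr0.
by rewrite normed_series_exp_coeff; exact: is_cvg_series_exp_coeff.
Qed.

Lemma exponential_sum {R : realType} (s : R) : abs_sum (weight 1 0 s) (expR s).
Proof.
have -> : weight 1 0 s = exp_coeff s.
  apply/funext => n; rewrite /weight /exp_coeff /phi big1 ?mul1r// => i _.
  by rewrite mul0r addr0.
split; first by rewrite normed_series_exp_coeff; exact: is_cvg_series_exp_coeff.
exact: is_cvg_series_exp_coeff.
Qed.

Section BinomialSum.
Context {R : realType}.
Implicit Types (N n : nat) (s : R).

Lemma phi_ffact N n : phi (N%:R : R) (-1) n = (N ^_ n)%:R.
Proof.
elim: n => [|n IH]; first by rewrite phi0 ffactn0.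
by rewrite phiS IH ffactSr_natr mulN1r mulrC.
Qed.

Lemma weight_binomial N s n : weight N%:R (-1) s n = 'C(N, n)%:R * s ^+ n.
Proof.
rewrite /weight phi_ffact -bin_ffact natrM.
by have n0 : n`!%:R != 0 :> R := fact_neq0 n; field.
Qed.

Lemma binomial_sum N s : abs_sum (weight N%:R (-1) s) ((1 + s) ^+ N).
Proof.
have := @abs_sum_finite _ (weight N%:R (-1) s) N.+1; rewrite exprDn.
rewrite (eq_bigr (fun i : 'I_N.+1 => 1 ^+ (N - i) * s ^+ i *+ 'C(N, i))) =>
  [|i _]; last first.
  by rewrite weight_binomial expr1n mul1r mulr_natl.
by apply => n Nn; rewrite weight_binomial bin_small// mul0r.
Qed.

Lemma binomial_summable N s :
  exists2 e : R, 0 < e &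
    cvgn [normed series (weight N%:R (-1) (s * (1 + e) ^+ 2))].
Proof. by exists 1 => //; have [] := binomial_sum N (s * (1 + 1) ^+ 2). Qed.

End BinomialSum.

(** * The three processes *)

Section Families.
Context {R : realType}.
Implicit Types (k p q r s t : R) (N m n x y : nat) (mu h : nat -> R)
  (D E : nat -> nat -> R).

Lemma dual_bond_identity alpha sigma t (S : pred nat) (c : nat -> nat -> R) :
  (forall u, S u -> phi alpha sigma u != 0) ->
  (forall u v, c u v = u%:R * (alpha + sigma * v%:R)) ->
  bond_identity S c (dual alpha sigma t).
Proof.
move=> Sphi cE x1 x2 y1 y2 S1 S2 T1 T2; rewrite /hop !cE.
have := dual_bond t (Sphi _ S1) (Sphi _ S2) (Sphi _ T1) (Sphi _ T2) => /= h.
by rewrite [dual _ _ _ x2.-1 _ * _]mulrC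
  [dual _ _ _ x2 y2 * dual _ _ _ _ _]mulrC
  [dual _ _ _ x2 y2.-1 * _]mulrC.
Qed.

Lemma ffact_ratio x y : (y <= x)%N -> x`!%:R / (x - y)`!%:R = (x ^_ y)%:R :> R.
Proof. by move=> yx; rewrite -(ffact_fact yx) natrM mulfK// fact_neq0. Qed.

Definition biorthogonal_sum mu h D E := forall m n,
  abs_sum (fun z => D z m * E z n * mu z) ((m == n)%:R * h m).

Lemma biorthogonal_sum_nat mu h D E :
  biorthogonal_sum mu h D E -> biorthogonal_nat mu h D E.
Proof. by move=> H m n; split; [exact: (H m n).1|exact: abs_sum_lim (H m n)].
  Qed.

Lemma biorthogonal_sum_scale mu h D E C : biorthogonal_sum mu h D E ->
  biorthogonal_sum (fun z => mu z * C) (fun m => C * h m) D E.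
Proof.
move=> H m n; have := abs_sumZ C (H m n); rewrite mulrCA; apply: eq_abs_sum =>
  z.
by ring.
Qed.

(** For a proportional pair the constant is absorbed by the weight, which turns biorthogonality into
    orthogonality. *)
Lemma biorthogonal_sum_transfer mu h D E C : biorthogonal_sum mu h D E ->
  (forall x n, E x n = C * D x n) -> biorthogonal_sum (fun z => mu z * C) h D D.
Proof.
move=> H ED m n; apply: eq_abs_sum (H m n) => z.
by rewrite ED; ring.
Qed.

Lemma eq_inner_nat_transfer mu D E C m n : (forall x n, E x n = C * D x n) ->
  inner_nat mu (fun x => D x m) (fun x => E x n) =
  inner_nat (fun z => mu z * C) (fun x => D x m) (fun x => D x n).
Proof.
move=> ED; rewrite /inner_nat; congr (limn (series _)); apply/funext => z.
by rewrite ED; ring.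
Qed.

(** * Inclusion process: [alpha = 2k], [sigma = 1] *)

Section SIP.
Variable k : R.
Hypothesis k0 : 0 < k.
Let k2 : 0 < 2 * k. Proof. by rewrite mulr_gt0. Qed.
Notation phi := (phi (2 * k) 1).
Notation dual := (dual (2 * k) 1).

Let phi_n0 n : phi n != 0. Proof. by rewrite lt0r_neq0// phi_gt0. Qed.

Let poch_phi m : poch (2 * k) m = 1 ^+ m * phi m.
Proof. by rewrite expr1n mul1r; apply: eq_bigr => i _; rewrite mul1r. Qed.

Lemma F21_SIP z x n : F21 (- x%:R) (- n%:R) (2 * k) z = dual z x n.
Proof. by rewrite (@F21_dual _ (2 * k) 1 _ 1)// divr1. Qed.

Lemma mu_SIP_weight q : mu_SIP k q = weight (2 * k) 1 q.
Proof.
apply/funext => z; rewrite /mu_SIP Gamma_poch// poch_phi expr1n mul1r /weight.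
have g0 : Gamma (2 * k) != 0 by rewrite lt0r_neq0// Gamma_gt0.
by have z0 : z`!%:R != 0 :> R := fact_neq0 z; field; rewrite z0.
Qed.

Lemma Dcl_SIP_classical r x y : Dcl_SIP k r x y =
  classical (2 * k) 1 (- r^-1) x y.
Proof.
rewrite /Dcl_SIP /classical; case: leqP => [yx|xy];
  last by rewrite ffact_small// !mul0r.
rewrite ffact_ratio// Gamma_poch// poch_phi expr1n mul1r invfM mulVKf//.
by rewrite lt0r_neq0// Gamma_gt0.
Qed.

Lemma D_SIP_dual q : q != 0 -> D_SIP k q = dual q^-1.
Proof.
move=> q0; apply/funext => x; apply/funext => n; apply: abs_sum_lim.
apply: eq_abs_sum (dual_abs_sum _ _ _ x n) => z.
rewrite !Dcl_SIP_classical mu_SIP_weight classical_pairing//.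
by congr (dual_coef _ _ _ _ * _ * _); rewrite sqrrN; field.
Qed.

Lemma Dt_SIP_closed_dual p q x n : Dt_SIP_closed k p q x n =
  (- (q / (p * (1 - q)))) ^+ (x + n) * (1 - q) `^ (- (2 * k)) * dual q^-1 x n.
Proof. by rewrite /Dt_SIP_closed F21_SIP addnC. Qed.

Lemma Dt_SIP_abs_sum p q x n : p != 0 -> q != 0 -> `|q| < 1 ->
  abs_sum (fun z => Dcl_SIP k p z x * Dcl_SIP k p z n * mu_SIP k q z)
    (Dt_SIP_closed k p q x n).
Proof.
move=> p0 q0 q1.
have q1' : 1 - 1 * q != 0 by rewrite lt0r_neq0// mul1r; move: q1;
  rewrite ltr_norml; lra.
have [e e0 He] := negative_binomial_summable k2 q1.
have := classical_transpose_abs_sum q0 q1' e0 He (negative_binomial_sum k2 q1)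
  (- p^-1) (phi_n0 x) (phi_n0 n).
rewrite Dt_SIP_closed_dual mul1r in q1' *.
rewrite (_ : - p^-1 * (q / (1 - q)) = - (q / (p * (1 - q)))); last first.
  by field; rewrite p0 q1'.
by apply: eq_abs_sum => z; rewrite !Dcl_SIP_classical mu_SIP_weight.
Qed.

Lemma D_SIP_bond q : q != 0 -> bond_identity predT (rate_SIP k) (D_SIP k q).
Proof.
by move=> q0; rewrite D_SIP_dual//; apply: dual_bond_identity => // u v;
  rewrite mul1r.
Qed.

Lemma Dt_SIP_closed_bond p q :
  bond_identity predT (rate_SIP k) (Dt_SIP_closed k p q).
Proof.
apply: (@bond_identity_scale _ _ _ (dual q^-1)).
- by move=> v; rewrite /rate_SIP mul0r.
- exact: Dt_SIP_closed_dual.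
- by apply: dual_bond_identity => // u v; rewrite mul1r.
Qed.

(** The parameter [s = - q / (1 - q)] solves [1 - 1/s = 1/q]. For [q < 1] the weight at [s] is
    summable when [|q| < 1 - q], which is the bound [q < 1/2]. *)
Lemma SIP_biorthogonal p q : 0 < p -> q != 0 -> q < 2^-1 ->
  biorthogonal_sum (mu_SIP k p) (fun m => (mu_SIP k p m)^-1)
    (D_SIP k q) (Dt_SIP_closed k p q).
Proof.
move=> p0 q0 qh m n; have p0' := lt0r_neq0 p0.
have q1 : 0 < 1 - q by lra.
have q1' := lt0r_neq0 q1.
pose s := - q / (1 - q).
have s0 : s != 0 by rewrite /s mulf_neq0 ?oppr_eq0 ?invr_eq0.
have ss : 1 - s = (1 - q)^-1 by rewrite /s; field.
have s1 : `|s| < 1.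
  rewrite /s normrM normrV ?unitfE// normrN (gtr0_norm q1) ltr_pdivrMr// mul1r.
  by rewrite ltr_norml; lra.
have ss' : 1 - 1 * s != 0 by rewrite mul1r ss invr_eq0.
have [e e0 He] := negative_binomial_summable k2 s1.
have tE : 1 - s^-1 = q^-1 by rewrite /s; field; rewrite ?q0 ?q1'.
have := @dual_biorthogonal _ _ _ _ _ _ s0 ss' e0 He
  (negative_binomial_sum k2 s1)
  (- (q / (p * (1 - q)))) p ((1 - q) `^ (- (2 * k))) m n _ _ (phi_n0 m)
    (phi_n0 n).
rewrite tE D_SIP_dual// mu_SIP_weight => H.
apply: eq_abs_sum (H _ _) => [z||].
- by rewrite Dt_SIP_closed_dual addnC.
- by rewrite /s; field; rewrite p0' q1'.
- rewrite ss -(powR_inv1 (ltW q1)) -powRrM mulN1r opprK -powRD ?addNr ?powRr0//.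
  by rewrite q1' implybT.
Qed.

End SIP.

(** * Exclusion process: [alpha = N], [sigma = -1] *)

Section SEP.
Variable N : nat.
Notation phi := (phi (N%:R : R) (-1)).
Notation dual := (dual (N%:R : R) (-1)).

Let phi_n0 n : (n <= N)%N -> phi n != 0.
Proof. by move=> nN; rewrite phi_ffact pnatr_eq0 -lt0n ffact_gt0. Qed.

Lemma F21_SEP z x n : F21 (- x%:R) (- n%:R) (- N%:R) z = dual (- z) x n.
Proof.
rewrite (@F21_dual _ N%:R (-1) _ (-1)) ?invrN1 ?mulrN1// => m.
by rewrite poch_oppn phi_ffact.
Qed.

Lemma mu_SEP_weight q : mu_SEP N q = weight N%:R (-1) (q / (1 - q)).
Proof. by apply/funext => z; rewrite weight_binomial. Qed.

Lemma Dcl_SEP_classical r x y : (y <= N)%N ->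
  Dcl_SEP N r x y = classical N%:R (-1) (- ((1 - r) / r)) x y.
Proof.
move=> yN; rewrite /Dcl_SEP /classical; case: leqP => [yx|xy];
  last by rewrite ffact_small// !mul0r.
rewrite ffact_ratio// phi_ffact -(ffact_ratio yN) invfM invrK.
by rewrite [_ * (N - y)`!%:R]mulrC.
Qed.

(** The weight is supported on [0..N], so results on series pass to the finite pairing. *)
Lemma inner_le_abs_sum (mu f g : nat -> R) a :
  (forall z, (N < z)%N -> mu z = 0) ->
  abs_sum (fun z => f z * g z * mu z) a -> inner_le N mu f g = a.
Proof.
move=> mu0 H; apply: abs_sum_unique H; apply: abs_sum_finite => z Nz.
by rewrite mu0 ?mulr0.
Qed.

Let mu_SEP0 q z : (N < z)%N -> mu_SEP N q z = 0.
Proof. by move=> Nz; rewrite /mu_SEP bin_small// mul0r. Qed.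

Lemma D_SEP_dual q : q != 0 -> q != 1 -> D_SEP N q = dual ((1 - q) / q).
Proof.
move=> q0 q1; have q1' : 1 - q != 0 by rewrite subr_eq0 eq_sym.
apply/funext => x; apply/funext => n.
apply: abs_sum_unique (dual_abs_sum _ _ _ x n).
rewrite /D_SEP /inner_le.
rewrite (eq_bigr
  (fun z : 'I_N.+1 =>
  dual_coef N%:R (-1) ((1 - q) / q) z * (x ^_ z)%:R * (n ^_ z)%:R)).
  apply: abs_sum_finite => z Nz.
  by rewrite /dual_coef phi_ffact ffact_small// mul0r invr0 mulr0 !mul0r.
move=> z _; have zN : (z <= N)%N by rewrite -ltnS.
rewrite !Dcl_SEP_classical// mu_SEP_weight classical_pairing ?phi_n0//.
by congr (dual_coef _ _ _ _ * _ * _); rewrite sqrrN; field; rewrite q0 q1'.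
Qed.

Lemma Dt_SEP_dual p q x n : p != 0 -> q != 0 -> q != 1 -> (x <= N)%N ->
  (n <= N)%N ->
  Dt_SEP N p q x n =
  (q * (p - 1) / p) ^+ (x + n) * (1 - q) ^- N * dual ((1 - q) / q) x n.
Proof.
move=> p0 q0 q1 xN nN; have q1' : 1 - q != 0 by rewrite subr_eq0 eq_sym.
(* With this [s] one has [1 + s = 1 / (1 - q)], so the factor [s / (1 - sigma s)] of the closed form
   is [q]. *)
pose s := q / (1 - q).
have s0 : s != 0 by rewrite mulf_neq0 ?invr_eq0.
have ss : 1 - (-1) * s = (1 - q)^-1 by rewrite /s; field.
have ss' : 1 - (-1) * s != 0 by rewrite ss invr_eq0.
have [e e0 He] := binomial_summable N s.
have := classical_transpose_abs_sum s0 ss' e0 He (binomial_sum N s)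
  (- ((1 - p) / p)) (phi_n0 xN) (phi_n0 nN).
rewrite (_ : 1 + s = (1 - q)^-1); last by rewrite -ss mulN1r opprK.
rewrite ss invrK (_ : - ((1 - p) / p) * (s * (1 - q)) = q * (p - 1) / p);
  last first.
  by rewrite /s; field; rewrite p0 q1'.
rewrite [s^-1]invf_div exprVn => H.
apply: inner_le_abs_sum; first by move=> z; exact: mu_SEP0.
by apply: eq_abs_sum H => z; rewrite !Dcl_SEP_classical// mu_SEP_weight.
Qed.

Let rate_SEPE u v : rate_SEP R N u v = u%:R * (N%:R + -1 * v%:R).
Proof. by rewrite /rate_SEP mulN1r. Qed.

Lemma D_SEP_bond q : q != 0 -> q != 1 ->
  bond_identity (fun u => (u <= N)%N) (rate_SEP R N) (D_SEP N q).
Proof.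
by move=> q0 q1; rewrite D_SEP_dual//; apply: dual_bond_identity;
  [exact: phi_n0|exact: rate_SEPE].
Qed.

Lemma Dt_SEP_bond p q : p != 0 -> q != 0 -> q != 1 ->
  bond_identity (fun u => (u <= N)%N) (rate_SEP R N) (Dt_SEP N p q).
Proof.
move=> p0 q0 q1.
apply: (@eq_bond_identity
  _ _ _ (fun x n =>
  (q * (p - 1) / p) ^+ (x + n) * (1 - q) ^- N * dual ((1 - q) / q) x n)).
- by move=> u; apply: leq_trans; exact: leq_pred.
- move=> u v uN; rewrite leq_eqVlt => /predU1P[->|vN]; last by left.
  by right; rewrite /rate_SEP subrr mulr0.
- by move=> x y xN yN; rewrite Dt_SEP_dual.
apply: (@bond_identity_scale _ _ _ (dual ((1 - q) / q)) _ _ _ _ _ _) => //.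
- by move=> v; rewrite /rate_SEP mul0r.
- by apply: dual_bond_identity; [exact: phi_n0|exact: rate_SEPE].
Qed.

Lemma SEP_biorthogonal p q : 0 < p -> p < 1 -> q != 0 -> q != 1 ->
  biorthogonal_le N (mu_SEP N p) (fun m => (mu_SEP N p m)^-1) (D_SEP N q)
    (Dt_SEP N p q).
Proof.
move=> p0 p1 q0 q1 m n mN nN; have p0' := lt0r_neq0 p0.
have q1' : 1 - q != 0 by rewrite subr_eq0 eq_sym.
have p1' : 1 - p != 0 by rewrite lt0r_neq0// subr_gt0.
(* The weight [mu_SEP N p] has parameter [p / (1 - p)], and multiplying it by [q (p - 1) / p] gives
   [- q]. *)
pose s := - q.
have s0 : s != 0 by rewrite oppr_eq0.
have ss' : 1 - (-1) * s != 0 by rewrite mulN1r opprK.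
have [e e0 He] := binomial_summable N s.
have tE : -1 - s^-1 = (1 - q) / q by rewrite /s; field; rewrite ?oppr_eq0.
have := @dual_biorthogonal _ _ _ _ _ _ s0 ss' e0 He (binomial_sum N s)
  (q * (p - 1) / p) (p / (1 - p)) ((1 - q) ^- N) m n _ _ (phi_n0 mN)
    (phi_n0 nN).
rewrite tE -mu_SEP_weight -D_SEP_dual// => H.
rewrite -(inner_le_abs_sum (mu_SEP0 p) (H _ _)).
- apply: eq_bigr => z _; have zN : (z <= N)%N by rewrite -ltnS.
  by rewrite (Dt_SEP_dual p0' q0 q1 zN nN) addnC (D_SEP_dual q0 q1).
- by rewrite /s; field; rewrite p0' p1'.
- by rewrite mulVf// expf_neq0.
Qed.

End SEP.

(** * Independent walkers: [alpha = 1], [sigma = 0] *)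

Section IRW.
Notation phi := (phi (1 : R) 0).
Notation dual := (dual (1 : R) 0).

Let phi1 n : phi n = 1.
Proof. by apply: big1 => i _; rewrite mul0r addr0. Qed.

Let phi_n0 n : phi n != 0. Proof. by rewrite phi1 oner_eq0. Qed.

Lemma F20_IRW z x n : F20 (- x%:R) (- n%:R) z = dual z x n.
Proof. exact: F20_dual. Qed.

Lemma mu_IRW_weight q : mu_IRW q = weight 1 0 q.
Proof. by apply/funext => z; rewrite /weight phi1 mul1r. Qed.

Lemma Dcl_IRW_classical r x y : Dcl_IRW r x y = classical 1 0 (- r^-1) x y.
Proof.
rewrite /Dcl_IRW /classical phi1 divr1; case: leqP => [yx|xy];
  last by rewrite ffact_small// !mul0r.
by rewrite ffact_ratio.
Qed.

Lemma D_IRW_dual q : q != 0 -> D_IRW q = dual q^-1.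
Proof.
move=> q0; apply/funext => x; apply/funext => n; apply: abs_sum_lim.
apply: eq_abs_sum (dual_abs_sum _ _ _ x n) => z.
rewrite !Dcl_IRW_classical mu_IRW_weight classical_pairing//.
by congr (dual_coef _ _ _ _ * _ * _); rewrite sqrrN; field.
Qed.

Lemma Dt_IRW_abs_sum p q x n : p != 0 -> q != 0 ->
  abs_sum (fun z => Dcl_IRW p z x * Dcl_IRW p z n * mu_IRW q z)
    ((- (q / p)) ^+ (x + n) * expR q * dual q^-1 x n).
Proof.
move=> p0 q0.
have q1' : 1 - 0 * q != 0 by rewrite mul0r subr0 oner_eq0.
have [e e0 He] := exponential_summable q.
have := classical_transpose_abs_sum q0 q1' e0 He (exponential_sum q) (- p^-1)
  (phi_n0 x) (phi_n0 n).
rewrite (_ : - p^-1 * (q / (1 - 0 * q)) = - (q / p)); last first.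
  by rewrite mul0r subr0; field.
by apply: eq_abs_sum => z; rewrite !Dcl_IRW_classical mu_IRW_weight.
Qed.

Lemma Dt_IRW_dual p q x n : p != 0 -> q != 0 ->
  Dt_IRW p q x n = (- (q / p)) ^+ (x + n) * expR q * dual q^-1 x n.
Proof. by move=> p0 q0; exact: abs_sum_lim (Dt_IRW_abs_sum x n p0 q0). Qed.

Let rate_IRWE u v : rate_IRW R u v = u%:R * (1 + 0 * v%:R).
Proof. by rewrite /rate_IRW mul0r addr0 mulr1. Qed.

Lemma D_IRW_bond q : q != 0 -> bond_identity predT (@rate_IRW R) (D_IRW q).
Proof.
by move=> q0; rewrite D_IRW_dual//; apply: dual_bond_identity => // u v;
  exact: rate_IRWE.
Qed.

Lemma Dt_IRW_bond p q : p != 0 -> q != 0 ->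
  bond_identity predT (@rate_IRW R) (Dt_IRW p q).
Proof.
move=> p0 q0; apply: (@bond_identity_scale _ _ _ (dual q^-1)) => //.
- by move=> x n; exact: Dt_IRW_dual.
- by apply: dual_bond_identity => // u v; exact: rate_IRWE.
Qed.

Lemma IRW_biorthogonal p q : 0 < p -> q != 0 ->
  biorthogonal_sum (mu_IRW p) (fun m => (mu_IRW p m)^-1) (D_IRW q) (Dt_IRW p q).
Proof.
move=> p0 q0 m n; have p0' := lt0r_neq0 p0.
pose s := - q.
have s0 : s != 0 by rewrite oppr_eq0.
have ss' : 1 - 0 * s != 0 by rewrite mul0r subr0 oner_eq0.
have [e e0 He] := exponential_summable s.
have tE : 0 - s^-1 = q^-1 by rewrite /s; field; rewrite ?oppr_eq0.
have := @dual_biorthogonal _ _ _ _ _ _ s0 ss' e0 He (exponential_sum s)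
  (- (q / p)) p (expR q) m n _ _ (phi_n0 m) (phi_n0 n).
rewrite tE D_IRW_dual// mu_IRW_weight => H.
apply: eq_abs_sum (H _ _) => [z||].
- by rewrite Dt_IRW_dual// addnC.
- by rewrite /s; field.
- by rewrite /s expRxMexpNx_1.
Qed.

End IRW.

End Families.

(** * Self-duality, biorthogonality and the Meixner, Krawtchouk and Charlier cases *)

Unset Implicit Arguments.
Local Close Scope classical_set_scope.

Theorem proposition4p7 (R : realType) :
  (* SIP(2k) *)
  (forall k p : R, 0 < k -> 0 < p -> p < 1 ->
    (forall q : R, q != 0 ->
      [/\ (forall x n : nat,
             D_SIP k q x n = F21 (- x%:R) (- n%:R) (2 * k) q^-1),
          self_duality predT (rate_SIP k) (D_SIP k q),
          (`|q| < 1 ->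
             [/\ (forall x n : nat,
                    inner_nat_cvg (mu_SIP k q)
                      (fun z => Dcl_SIP k p z x) (fun z => Dcl_SIP k p z n)),
                 (forall x n : nat,
                    Dt_SIP k p q x n =
                    (- (q / (p * (1 - q)))) ^+ (n + x) *
                    (1 - q) `^ (- (2 * k)) *
                    F21 (- x%:R) (- n%:R) (2 * k) q^-1) &
                 self_duality predT (rate_SIP k) (Dt_SIP k p q)]),
          (- 1 < q -> q < 2^-1 ->
             biorthogonal_nat (mu_SIP k p) (fun m => (mu_SIP k p m)^-1)
               (D_SIP k q) (Dt_SIP k p q) /\
             biorthogonal_nat (w_SIP k p)
               (fun m => (1 - p) `^ (2 * k) / mu_SIP k p m)
               (D_SIP k q) (Dt_SIP k p q)) &
          (* closed form, whose domain is not limited to `|q| < 1 *)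
          (q < 1 -> self_duality predT (rate_SIP k) (Dt_SIP_closed k p q)) /\
          (q < 2^-1 ->
             biorthogonal_nat (mu_SIP k p) (fun m => (mu_SIP k p m)^-1)
               (D_SIP k q) (Dt_SIP_closed k p q) /\
             biorthogonal_nat (w_SIP k p)
               (fun m => (1 - p) `^ (2 * k) / mu_SIP k p m)
               (D_SIP k q) (Dt_SIP_closed k p q))]) /\
    (forall q : R, q^-1 = 1 - p^-1 ->
      [/\ (forall x n : nat, D_SIP k q x n = meixner k p x n),
          (`|q| < 1 ->
             (forall x n : nat,
                Dt_SIP k p q x n = (1 - p) `^ (2 * k) * D_SIP k q x n) /\
             (forall m n : nat,
                inner_nat (mu_SIP k p)
                  (fun x => D_SIP k q x m) (fun x => Dt_SIP k p q x n) =
                inner_nat (w_SIP k p)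
                  (fun x => meixner k p x m) (fun x => meixner k p x n))),
          (forall x n : nat,
             Dt_SIP_closed k p q x n = (1 - p) `^ (2 * k) * D_SIP k q x n),
          (forall m n : nat,
             inner_nat (mu_SIP k p)
               (fun x => D_SIP k q x m) (fun x => Dt_SIP_closed k p q x n) =
             inner_nat (w_SIP k p)
               (fun x => meixner k p x m) (fun x => meixner k p x n)) &
          biorthogonal_nat (w_SIP k p) (fun m => (mu_SIP k p m)^-1)
            (meixner k p) (meixner k p)])) /\
  (* SEP(2j), N = 2j *)
  (forall (N : nat) (p : R), (0 < N)%N -> 0 < p -> p < 1 ->
    (forall q : R, q != 0 -> q != 1 ->
      [/\ (forall x n : nat, (x <= N)%N -> (n <= N)%N ->
             D_SEP N q x n =
             F21 (- x%:R) (- n%:R) (- N%:R) ((q - 1) / q)),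
          (forall x n : nat, (x <= N)%N -> (n <= N)%N ->
             Dt_SEP N p q x n =
             (q * (p - 1) / p) ^+ (n + x) * (1 - q) ^- N *
             F21 (- x%:R) (- n%:R) (- N%:R) ((q - 1) / q)),
          self_duality (fun u => (u <= N)%N) (rate_SEP R N) (D_SEP N q),
          self_duality (fun u => (u <= N)%N) (rate_SEP R N) (Dt_SEP N p q) &
          biorthogonal_le N (mu_SEP N p) (fun m => (mu_SEP N p m)^-1)
            (D_SEP N q) (Dt_SEP N p q) /\
          biorthogonal_le N (w_SEP N p)
            (fun m => (1 - p) ^+ N / mu_SEP N p m)
            (D_SEP N q) (Dt_SEP N p q)]) /\
    (forall q : R, q^-1 = 1 - p^-1 ->
      [/\ (forall x n : nat, (x <= N)%N -> (n <= N)%N ->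
             D_SEP N q x n = krawtchouk N p x n),
          (forall x n : nat, (x <= N)%N -> (n <= N)%N ->
             Dt_SEP N p q x n = (1 - p) ^+ N * D_SEP N q x n),
          (forall m n : nat, (m <= N)%N -> (n <= N)%N ->
             inner_le N (mu_SEP N p)
               (fun x => D_SEP N q x m) (fun x => Dt_SEP N p q x n) =
             inner_le N (w_SEP N p)
               (fun x => krawtchouk N p x m) (fun x => krawtchouk N p x n)) &
          biorthogonal_le N (w_SEP N p) (fun m => (mu_SEP N p m)^-1)
            (krawtchouk N p) (krawtchouk N p)])) /\
  (* IRW *)
  (forall p : R, 0 < p ->
    (forall q : R, q != 0 ->
      [/\ (forall x n : nat,
             D_IRW q x n = F20 (- x%:R) (- n%:R) q^-1),
          (forall x n : nat,
             inner_nat_cvg (mu_IRW q)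
               (fun z => Dcl_IRW p z x) (fun z => Dcl_IRW p z n) /\
             Dt_IRW p q x n =
             (- (q / p)) ^+ (x + n) * expR q * F20 (- x%:R) (- n%:R) q^-1),
          self_duality predT (@rate_IRW R) (D_IRW q),
          self_duality predT (@rate_IRW R) (Dt_IRW p q) &
          biorthogonal_nat (mu_IRW p) (fun m => (mu_IRW p m)^-1)
            (D_IRW q) (Dt_IRW p q) /\
          biorthogonal_nat (w_IRW p) (fun m => expR (- p) / mu_IRW p m)
            (D_IRW q) (Dt_IRW p q)]) /\
    (forall q : R, q = - p ->
      [/\ (forall x n : nat, D_IRW q x n = charlier p x n),
          (forall x n : nat, Dt_IRW p q x n = expR (- p) * D_IRW q x n),
          (forall m n : nat,
             inner_nat (mu_IRW p)
               (fun x => D_IRW q x m) (fun x => Dt_IRW p q x n) =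
             inner_nat (w_IRW p)
               (fun x => charlier p x m) (fun x => charlier p x n)) &
          biorthogonal_nat (w_IRW p) (fun m => (mu_IRW p m)^-1)
            (charlier p) (charlier p)])).
Proof.
have specialP (p q : R) : 0 < p -> p < 1 -> q^-1 = 1 - p^-1 ->
    q = - (p / (1 - p)) /\ 1 - q = (1 - p)^-1.
  move=> p0 p1 qp; have p0' := lt0r_neq0 p0.
  have p1' : 1 - p != 0 by rewrite lt0r_neq0// subr_gt0.
  suff -> : q = - (p / (1 - p)) by split=> //; field.
  rewrite -[q]invrK qp -[RHS]invrK; congr (_^-1).
  by rewrite -mulrN invfM invrN invrK; field.
split; [|split].
- move=> k p k0 p0 p1; have p0' := lt0r_neq0 p0.
  have closedE q : q != 0 -> `|q| < 1 -> Dt_SIP k p q = Dt_SIP_closed k p q.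
    move=> q0 q1; apply/funext => x; apply/funext => n.
    exact: abs_sum_lim (Dt_SIP_abs_sum k0 x n p0' q0 q1).
  split=> q.
    move=> q0; split.
    + by move=> x n; rewrite D_SIP_dual// F21_SIP.
    + exact: bond_identity_self_duality (D_SIP_bond k0 q0).
    + move=> q1; split.
      * by move=> x n; exact: (Dt_SIP_abs_sum k0 x n p0' q0 q1).1.
      * by move=> x n; rewrite closedE.
      * by rewrite closedE//;
          exact: bond_identity_self_duality (Dt_SIP_closed_bond k0 p q).
    (* Two constraints meet here: [|q| < 1] for the series defining [Dt_SIP], and [q < 1/2] for the
       pairing. *)
    + move=> q1 qh; have hq : `|q| < 1 by rewrite ltr_norml; lra.
      have H := SIP_biorthogonal k0 p0 q0 qh.
      rewrite closedE//; split; apply: biorthogonal_sum_nat => //.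
      exact: biorthogonal_sum_scale.
    + split=> [_|qh].
        exact: bond_identity_self_duality (Dt_SIP_closed_bond k0 p q).
      have H := SIP_biorthogonal k0 p0 q0 qh.
      split; apply: biorthogonal_sum_nat => //.
      exact: biorthogonal_sum_scale.
  move=> qp.
  have [qE q1] := specialP _ _ p0 p1 qp.
  have qlt0 : q < 0 by rewrite qE oppr_lt0 divr_gt0// subr_gt0.
  have q0 : q != 0 by rewrite lt_eqF.
  (* A negative [q] lies in the range of the closed form for all [0 < p < 1], although
     [|q| = p / (1 - p)] reaches [1] at [p = 1/2]. *)
  have qh : q < 2^-1 by lra.
  have DE : D_SIP k q = meixner k p.
    apply/funext => x; apply/funext => n.
    by rewrite D_SIP_dual// /meixner F21_SIP// qp.
  have DtE x n : Dt_SIP_closed k p q x n = (1 - p) `^ (2 * k) * D_SIP k q x n.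
    rewrite Dt_SIP_closed_dual D_SIP_dual//.
    have p1' : 1 - p != 0 by rewrite lt0r_neq0// subr_gt0.
    (* At the special [q] the base of the power is [1], so the two functions differ only by a
       constant. *)
    have -> : - (q / (p * (1 - q))) = 1 by rewrite q1 qE; field;
      rewrite p0' p1'.
    have p1p : 0 <= 1 - p by lra.
    by rewrite q1 expr1n mul1r -(powR_inv1 p1p) -powRrM mulN1r opprK.
  have H := biorthogonal_sum_transfer (SIP_biorthogonal k0 p0 q0 qh) DtE.
  split.
  + by move=> x n; rewrite DE.
  + move=> hq; rewrite closedE//; split=> // m n.
    by rewrite (eq_inner_nat_transfer _ _ _ DtE) DE.
  + exact: DtE.
  + by move=> m n; rewrite (eq_inner_nat_transfer _ _ _ DtE) DE.
  + by apply: biorthogonal_sum_nat; rewrite -DE.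
- move=> N p N0 p0 p1; have p0' := lt0r_neq0 p0.
  have scale (mu h : nat -> R) D E C : biorthogonal_le N mu h D E ->
      biorthogonal_le N (fun z => mu z * C) (fun m => C * h m) D E.
    move=> H m n mN nN; rewrite mulrCA -H// /inner_le mulr_sumr.
    by apply: eq_bigr => z _; ring.
  split=> q.
    move=> q0 q1; split.
    + by move=> x n _ _; rewrite D_SEP_dual// F21_SEP -mulNr opprB.
    + by move=> x n xN nN; rewrite Dt_SEP_dual// F21_SEP -mulNr opprB addnC.
    + exact: bond_identity_self_duality (D_SEP_bond q0 q1).
    + exact: bond_identity_self_duality (Dt_SEP_bond p0' q0 q1).
    + have H := @SEP_biorthogonal _ N _ _ p0 p1 q0 q1.
      by split=> //; exact: scale.
  move=> qp; have [qE q1] := specialP _ _ p0 p1 qp.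
  have p1' : 1 - p != 0 by rewrite lt0r_neq0// subr_gt0.
  have qlt0 : q < 0 by rewrite qE oppr_lt0 divr_gt0// subr_gt0.
  have q0 : q != 0 by rewrite lt_eqF.
  have qn1 : q != 1 by rewrite lt_eqF//; lra.
  have DE : D_SEP N q = krawtchouk N p.
    apply/funext => x; apply/funext => n.
    rewrite D_SEP_dual// /krawtchouk F21_SEP; congr (dual _ _ _ _ _).
    by rewrite mulrBl mulfV// mul1r qp; ring.
  have DtE x n : (x <= N)%N -> (n <= N)%N ->
      Dt_SEP N p q x n = (1 - p) ^+ N * D_SEP N q x n.
    move=> xN nN; rewrite Dt_SEP_dual// D_SEP_dual//.
    have -> : q * (p - 1) / p = 1 by rewrite qE; field; rewrite p0' p1'.
    by rewrite q1 expr1n mul1r exprVn invrK.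
  have transfer m n : (m <= N)%N -> (n <= N)%N ->
      inner_le N (mu_SEP N p) (fun x => D_SEP N q x m)
        (fun x => Dt_SEP N p q x n) =
      inner_le N (w_SEP N p) (fun x => krawtchouk N p x m)
        (fun x => krawtchouk N p x n).
    move=> mN nN; apply: eq_bigr => z _; have zN : (z <= N)%N by rewrite -ltnS.
    by rewrite DtE// -DE /w_SEP; ring.
  split=> //.
  + by move=> x n _ _; rewrite DE.
  + by move=> m n mN nN; rewrite -transfer// SEP_biorthogonal.
- move=> p p0; have p0' := lt0r_neq0 p0.
  split=> q.
    move=> q0; split.
    + by move=> x n; rewrite D_IRW_dual// F20_IRW.
    + move=> x n; split; first exact: (Dt_IRW_abs_sum x n p0' q0).1.
      by rewrite Dt_IRW_dual// F20_IRW.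
    + exact: bond_identity_self_duality (D_IRW_bond q0).
    + exact: bond_identity_self_duality (Dt_IRW_bond p0' q0).
    + have H := IRW_biorthogonal p0 q0.
      split; apply: biorthogonal_sum_nat => //.
      exact: biorthogonal_sum_scale.
  move=> qp; have q0 : q != 0 by rewrite qp oppr_eq0.
  have DE : D_IRW q = charlier p.
    apply/funext => x; apply/funext => n.
    by rewrite D_IRW_dual// /charlier F20_IRW qp invrN.
  have DtE x n : Dt_IRW p q x n = expR (- p) * D_IRW q x n.
    rewrite Dt_IRW_dual// D_IRW_dual//.
    have -> : - (q / p) = 1 by rewrite qp mulNr opprK mulfV.
    by rewrite expr1n mul1r qp.
  have H := biorthogonal_sum_transfer (IRW_biorthogonal p0 q0) DtE.
  split.
  + by move=> x n; rewrite DE.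
  + exact: DtE.
  + by move=> m n; rewrite (eq_inner_nat_transfer _ _ _ DtE) DE.
  + by apply: biorthogonal_sum_nat; rewrite -DE.
Qed.
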